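(* Let $\mathbb{K}$ be a field and let $R=\mathbb{K}[X_1,\dots,X_m,Y_1,\dots,Y_{\tilde m}]$ be $\mathbb{Z}^2$-graded by $\deg X_i=(1,0)$ for all $i\in[m]$ and $\deg Y_i=(0,1)$ for all $i\in[\tilde m]$. For a formal Laurent series $H\in\mathbb{Z}(\!(t_1,t_2)\!)$, there exists a finitely generated graded $R$-module $M$ with $H=H_M$ if and only if $H$ satisfies the following conditions: (1) $H\ge0$, i.e. every coefficient of $H$ is nonnegative; (2) $H\cdot(1-t_1)^m\cdot(1-t_2)^{\tilde m}$ is a Laurent polynomial; and (3) the Hilbert polynomial $\mathcal{P}(H)$ has positive extremal coefficients.
   Context: $[m]=\{1,\dots,m\}$. $\mathbb{Z}(\!(t_1,t_2)\!)$ is the ring of formal series $\sum_{\mathbf{a}\in\mathbb{Z}^2}c_{\mathbf{a}}\mathbf{t}^{\mathbf{a}}$ with integer coefficients for which there is $\mathbf{b}\in\mathbb{Z}^2$ with $c_{\mathbf{a}}=0$ unless $\mathbf{a}\ge\mathbf{b}$ componentwise. The Hilbert series of a finitely generated graded module $M$ is $H_M=\sum_{\mathbf{a}\in\mathbb{Z}^2}(\dim_{\mathbb{K}}M_{\mathbf{a}})\,t_1^{a_1}t_2^{a_2}$. If $H\cdot(1-t_1)^{d_1}(1-t_2)^{d_2}$ is a Laurent polynomial for some $d_1,d_2\in\mathbb{N}$, the Hilbert polynomial $\mathcal{P}(H)\in\mathbb{Q}[Z_1,Z_2]$ is the unique polynomial such that for some $\mathbf{u}\in\mathbb{Z}^2$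 the coefficient of $\mathbf{t}^{\mathbf{a}}$ in $H$ equals $\mathcal{P}(H)(\mathbf{a})$ for all $\mathbf{a}\ge\mathbf{u}$. A monomial appearing (with nonzero coefficient) in a polynomial $p$ is extremal if it does not divide any other monomial appearing in $p$; $p$ has positive extremal coefficients if the coefficient of every extremal monomial of $p$ is positive (vacuously true for $p=0$). *)

(* Defs.v *)
From mathcomp Require Import all_boot all_order all_algebra.
From mathcomp.multinomials Require Export mpoly.
From Stdlib Require Import ClassicalEpsilon.

Set Implicit Arguments.
Unset Strict Implicit.
Unset Printing Implicit Defensive.

Import Order.TTheory GRing.Theory Num.Theory.
Local Open Scope ring_scope.

(* Bidegrees are elements of [int * int], with the library's componentwise
   additive group structure. *)

Definition le2 (a b : int * int) : bool := (a.1 <= b.1) && (a.2 <= b.2).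

(** * The ring Z((t1,t2)) *)

(* A series is given by its coefficient function; membership in Z((t1,t2)) is
   the existence of a lower bound for the support. *)
Definition laurent_series (H : int * int -> int) : Prop :=
  exists b : int * int, forall a, ~~ le2 b a -> H a = 0.

Definition laurent_polynomial (H : int * int -> int) : Prop :=
  exists s : seq (int * int), forall a, H a != 0 -> a \in s.

Definition mnm2 (k : 'X_{1..2}) : int * int := (Posz (k ord0), Posz (k ord_max)).

(* Cauchy product of a series with a polynomial in t1 = 'X_ord0 and
   t2 = 'X_ord_max. *)
Definition mul_series (H : int * int -> int) (q : {mpoly int[2]})
    (a : int * int) : int :=
  \sum_(k <- msupp q) q@_k * H (a - mnm2 k).

Definition denom (d1 d2 : nat) : {mpoly int[2]} :=
  (1 - 'X_ord0) ^+ d1 * (1 - 'X_ord_max) ^+ d2.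

Definition nonneg_series (H : int * int -> int) : Prop := forall a, 0 <= H a.

(** * Hilbert polynomial *)

Definition point2 (a : int * int) (i : 'I_2) : rat :=
  if i == ord0 then a.1%:~R else a.2%:~R.

Definition is_hilbert_poly (H : int * int -> int) (p : {mpoly rat[2]}) : Prop :=
  exists u : int * int, forall a, le2 u a -> (H a)%:~R = p.@[point2 a].

(* An arbitrary polynomial when [H] has no Hilbert polynomial; otherwise it is
   the unique one, see [hilbert_polyP] and [is_hilbert_poly_uniq]. *)
Definition hilbert_poly (H : int * int -> int) : {mpoly rat[2]} :=
  epsilon (inhabits 0) (is_hilbert_poly H).

Definition extremal (p : {mpoly rat[2]}) (k : 'X_{1..2}) : Prop :=
  k \in msupp p /\ forall l, l \in msupp p -> l != k -> ~~ (k <= l)%MM.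

Definition positive_extremal_coefs (p : {mpoly rat[2]}) : Prop :=
  forall k, extremal p k -> 0 < p@_k.

(** * Graded modules over K[X_1..X_m, Y_1..Y_mt] *)

(* The first [m] variables of {mpoly K[m + mt]} are the X's, the last [mt] the
   Y's. *)
Definition bideg (m mt : nat) (k : 'X_{1..(m + mt)%N}) : int * int :=
  (Posz (\sum_(i < m) k (lshift mt i)), Posz (\sum_(j < mt) k (rshift m j))).

Definition bihomogeneous (K : fieldType) (m mt : nat) (b : int * int)
    (p : {mpoly K[(m + mt)%N]}) : Prop :=
  forall k, k \in msupp p -> bideg k = b.

Section GradedModule.
Variables (K : fieldType) (m mt : nat) (M : lmodType {mpoly K[(m + mt)%N]}).

(* [G a] is the homogeneous component of bidegree [a]; the last two fields say
   that [M] is the (internal) direct sum of its components. *)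
Record is_grading (G : int * int -> M -> Prop) : Prop := IsGrading {
  grading0 : forall a, G a 0;
  gradingB : forall a x y, G a x -> G a y -> G a (x - y);
  gradingZ : forall a b (p : {mpoly K[(m + mt)%N]}) x,
    bihomogeneous b p -> G a x -> G (b + a) (p *: x);
  grading_sum : forall x, exists (s : seq (int * int)) (f : int * int -> M),
    (forall a, G a (f a)) /\ x = \sum_(a <- s) f a;
  grading_direct : forall (s : seq (int * int)) (f : int * int -> M),
    uniq s -> (forall a, G a (f a)) -> \sum_(a <- s) f a = 0 ->
    forall a, a \in s -> f a = 0 }.

Definition finitely_generated : Prop :=
  exists s : seq M, forall x, exists c : 'I_(size s) -> {mpoly K[(m + mt)%N]},
    x = \sum_(i < size s) c i *: s`_i.

(* The K-vector space V has a basis of cardinality d; K acts on M through the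
   constant polynomials. *)
Definition has_dim (V : M -> Prop) (d : nat) : Prop :=
  exists e : 'I_d -> M,
    [/\ forall i, V (e i),
        forall c : 'I_d -> K,
          \sum_(i < d) (c i)%:MP *: e i = 0 -> forall i, c i = 0
      & forall x, V x -> exists c : 'I_d -> K,
          x = \sum_(i < d) (c i)%:MP *: e i].

Definition is_hilbert_series (G : int * int -> M -> Prop)
    (H : int * int -> int) : Prop :=
  forall a, exists2 d : nat, has_dim (G a) d & H a = Posz d.

End GradedModule.

(** * The Hilbert polynomial is well defined *)

Lemma hilbert_polyP (H : int * int -> int) :
  (exists p, is_hilbert_poly H p) -> is_hilbert_poly H (hilbert_poly H).
Proof. exact: epsilon_spec. Qed.

Lemma poly_eq0_int (q : {poly rat}) (u : int) :
  (forall x : int, u <= x -> q.[x%:~R] = 0) -> q = 0.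
Proof.
move=> q0; pose r := [seq (u + Posz n)%:~R : rat | n <- iota 0 (size q)].
apply: (@roots_geq_poly_eq0 _ q r).
- by apply/allP=> _ /mapP[n _ ->]; apply/rootP/q0; rewrite lerDl.
- rewrite map_inj_uniq ?iota_uniq // => x y /intr_inj /addrI [].
  exact.
- by rewrite size_map size_iota.
Qed.

Lemma is_hilbert_poly_uniq (H : int * int -> int) (p q : {mpoly rat[2]}) :
  is_hilbert_poly H p -> is_hilbert_poly H q -> p = q.
Proof.
move=> [u Hu] [v Hv]; apply/eqP; rewrite -subr_eq0; apply/eqP.
set r := p - q.
pose w1 := Num.max u.1 v.1; pose w2 := Num.max u.2 v.2.
have r0 x y : w1 <= x -> w2 <= y -> r.@[point2 (x, y)] = 0.
  rewrite !ge_max => /andP[ux vx] /andP[uy vy].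
  by rewrite mevalB -Hu ?/le2 /= ?ux ?uy // -Hv ?/le2 /= ?vx ?vy // subrr.
have coef1 i y : w2 <= y ->
    \sum_(k <- msupp r | k ord0 == i) r@_k * y%:~R ^+ k ord_max = 0.
  move=> wy.
  pose Q : {poly rat} :=
    \sum_(k <- msupp r) (r@_k * y%:~R ^+ k ord_max) *: 'X^(k ord0).
  have Q0 : Q = 0.
    apply: (@poly_eq0_int _ w1) => x wx; rewrite -[RHS](r0 x y wx wy).
    rewrite horner_sum mevalE; apply: eq_bigr => k _.
    rewrite hornerZ hornerXn big_ord_recl big_ord1 /point2 /=.
    by rewrite (_ : lift ord0 ord0 = ord_max) ?mulrA 1?mulrAC //; apply/val_inj.
  have := congr1 (fun s : {poly rat} => s`_i) Q0.
  rewrite coef0 coef_sum => Qi; rewrite -[RHS]Qi.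
  rewrite big_mkcond; apply: eq_bigr => k _; rewrite coefZ coefXn eq_sym.
  by case: (i == _); rewrite ?mulr1 ?mulr0.
apply/mpolyP=> k; rewrite mcoeff0.
pose S : {poly rat} :=
  \sum_(l <- msupp r | l ord0 == k ord0) r@_l *: 'X^(l ord_max).
have S0 : S = 0.
  apply: (@poly_eq0_int _ w2) => y wy; rewrite -[RHS](coef1 (k ord0) y wy).
  by rewrite horner_sum; apply: eq_bigr => l _; rewrite hornerZ hornerXn.
have := congr1 (fun s : {poly rat} => s`_(k ord_max)) S0.
rewrite coef0 coef_sum; case: (boolP (k \in msupp r)) => [kr|]; last first.
  by rewrite mcoeff_msupp negbK => /eqP.
rewrite big_mkcond (bigD1_seq k) ?msupp_uniq //= eqxx coefZ coefXn eqxx mulr1.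
rewrite big1 ?addr0 // => l lk; case: eqP => // l0.
rewrite coefZ coefXn; case: eqP => [l1|]; last by rewrite mulr0.
case/eqP: lk; apply/mnmP=> i; case: (unliftP ord0 i) => [j ->|-> //].
by rewrite (_ : lift ord0 j = ord_max) //; apply/val_inj; rewrite /= ord1.
Qed.

(* Main.v *)
Require Import Defs.
From HB Require Import structures.
From mathcomp Require Import all_boot all_order all_algebra.
From mathcomp.multinomials Require Import ssrcomplements.
From mathcomp Require Import zify ring.
From Stdlib Require Import Classical ClassicalEpsilon.

(** Both directions go through one intermediate notion. Call cell the series
    t^c / ((1-t1)^i (1-t2)^j), and call [H] decomposable when it is a finite sum
    of cells with i <= m and j <= mt. The Hilbert series of finitely generated
    graded modules are exactly the decomposable series, and a series bounded
    below is decomposable exactly when the three conditions hold.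

    A cell is the Hilbert series of a shifted polynomial ring in i + j of the
    variables, on which the other variables act by zero, and direct sums of
    modules add Hilbert series ([decomposable_realizable]). Conversely, choose
    homogeneous generators of a module and order their monomial multiples by
    generator, then by a monomial order. The multiples that are not
    combinations of smaller ones of the same bidegree form a basis of each
    component ([component_dim]), and for each generator their exponents form a
    set closed under divisors ([standard_downset]). Such a set is a finite
    disjoint union of boxes, each coordinate of which is either fixed or only
    bounded below ([downset_boxes]), and counting the points of a box by
    bidegree gives a cell ([count_box]). This yields
    [hilbert_series_decomposable].

    A sum of cells satisfies the conditions: multiplication by
    (1-t1)^m (1-t2)^mt turns every cell into a Laurent polynomial, and the
    Hilbert polynomial of a cell is zero or has a positive coefficient at its
    top monomial, which all its other monomials divide, so that no
    cancellation can occur at an extremal monomial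
    ([decomposable_extremal]).

    Finally, let [H] satisfy the conditions, with Hilbert polynomial P
    ([conditions_decomposable]). Cut the plane at a point (U, U). On the quadrant
    above it, H = P is given by Newton's forward formula, whose basis functions
    binomial(w1, i) binomial(w2, j) are the coefficients of cells; so it
    suffices that the iterated differences of P at (U, U) be nonnegative.
    Such a difference is a polynomial in U whose leading coefficient is a
    positive combination of coefficients of P at monomials of maximal total
    degree among those that survive the differences. These monomials are
    extremal, so the differences are nonnegative for large U
    ([newton_poly_eventually]). What remains is made of finitely many rows and
    columns, where the same argument in one variable needs only the
    nonnegativity of [H] ([decomposable1_tail]). *)

Set Implicit Arguments.
Unset Strict Implicit.
Unset Printing Implicit Defensive.

Import Order.TTheory GRing.Theory Num.Theory.
Local Open Scope ring_scope.

(** * Powers of the geometric series *)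

(** The coefficient of t^z in 1/(1-t)^i. The truncated predecessor makes the
    formula right also for i = 0, where binomial(n-1, n) vanishes unless n = 0. *)
Definition geom (i : nat) (z : int) : int :=
  if z is Posz n then 'C((n + i).-1, n) else 0.

Lemma geom_neg i z : z < 0 -> geom i z = 0.
Proof. by case: z. Qed.

Lemma geom_ge0 i z : 0 <= geom i z.
Proof. by case: z. Qed.

Lemma geom0 z : geom 0 z = (z == 0).
Proof. by case: z => [[|n]|n] //=; rewrite addn0 bin_small. Qed.

(** Multiplying by 1 - t lowers the exponent of the denominator: this is Pascal's
    rule. *)
Lemma geomB i z : geom i.+1 z - geom i.+1 (z - 1) = geom i z.
Proof.
case: z => [[|n]|n] //; first by rewrite /= !bin0.
rewrite (_ : Posz n.+1 - 1 = n); last by lia.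
rewrite /= !addnS /= ?addSn binS; lia.
Qed.

(** The series t^i/(1-t)^(i+1) has the coefficients binomial(w, i), so a Newton
    expansion reads off a combination of such series. *)
Lemma geomS i (w : nat) : geom i.+1 (Posz w - Posz i) = 'C(w, i).
Proof.
case: (leqP i w) => [iw|wi]; last first.
  by rewrite geom_neg ?bin_small //; lia.
rewrite (_ : Posz w - Posz i = (w - i)%N); last by lia.
by rewrite /= addnS subnK //= bin_sub.
Qed.

Definition nabla (f : int -> int) (z : int) : int := f z - f (z - 1).

Lemma eq_iter_nabla k (f g : int -> int) :
  f =1 g -> iter k nabla f =1 iter k nabla g.
Proof. by move=> fg; elim: k => //= k IH z; rewrite /nabla !IH. Qed.

Lemma iter_nabla_geom i c :
  iter i nabla (fun z => geom i (z - c)) =1 (fun z : int => Posz (z == c)).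
Proof.
elim: i => [|i IH] z; first by rewrite /= geom0 subr_eq0.
rewrite iterSr -IH; apply: eq_iter_nabla => {}z.
by rewrite /nabla addrAC geomB.
Qed.

Lemma iter_nabla_fin k (f : int -> int) (s : seq int) :
  (forall z, f z != 0 -> z \in s) ->
  exists s' : seq int, forall z, iter k nabla f z != 0 -> z \in s'.
Proof.
move=> fs; elim: k => [|k [s' IH]]; first by exists s.
exists (s' ++ map (+%R^~ 1) s') => z; rewrite mem_cat /= /nabla.
case: (eqVneq (iter k nabla f z) 0) => [->|/IH -> //].
rewrite sub0r oppr_eq0 => /IH /(map_f (+%R^~ 1)) /=.
by rewrite subrK => ->; rewrite orbT.
Qed.

Lemma iter_nabla_geom_fin k i c : (i <= k)%N ->
  exists s : seq int,
    forall z, iter k nabla (fun z => geom i (z - c)) z != 0 -> z \in s.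
Proof.
move=> ik; rewrite -(subnK ik) iterD.
apply: (@iter_nabla_fin _ _ [:: c]) => z.
by rewrite iter_nabla_geom inE; case: (z == c).
Qed.

(** * Forward differences *)

Section ForwardDifference.
Variable V : zmodType.
Implicit Types f g : int -> V.

Definition fdiff f (z : int) : V := f (z + 1) - f z.

Lemma eq_iter_fdiff i f g u : (forall z, u <= z -> f z = g z) ->
  forall z, u <= z -> iter i fdiff f z = iter i fdiff g z.
Proof.
move=> fg; elim: i => //= i IH z uz; rewrite /fdiff !IH //; lia.
Qed.

Lemma iter_fdiff_shift i f c z :
  iter i fdiff (fun z => f (z + c)) z = iter i fdiff f (z + c).
Proof. by elim: i z => //= i IH z; rewrite /fdiff !IH addrAC. Qed.

(** By induction on [w], from f(u+w+1) = f(u+w) + (Delta f)(u+w) and Pascal's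
    rule. Forward differences are used because they only involve values of [f]
    above [u], where a Hilbert function is known to be polynomial. *)
Lemma newton f u (w : nat) :
  f (u + Posz w) = \sum_(i < w.+1) iter i fdiff f u *+ 'C(w, i).
Proof.
elim: w f => [|w IH] f; first by rewrite big_ord1 addr0.
have -> : f (u + Posz w.+1) = f (u + Posz w) + fdiff f (u + Posz w).
  by rewrite /fdiff addrCA subrr addr0; congr f; lia.
rewrite !IH [RHS]big_ord_recl [in LHS]big_ord_recl /= !bin0 -addrA; congr (_ + _).
rewrite [RHS](eq_bigr (fun i : 'I_w.+1 => iter i fdiff (fdiff f) u *+ 'C(w, i)
   + iter i fdiff (fdiff f) u *+ 'C(w, i.+1))); last first.
  by move=> i _; rewrite /= -iterSr /bump /= add1n binS mulrnDr addrC.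
rewrite big_split /= addrC; congr (_ + _).
rewrite [RHS]big_ord_recr /= bin_small // mulr0n addr0.
by apply: eq_bigr => i _; rewrite -iterSr /bump add1n.
Qed.

Lemma newton_trunc n f u (w : nat) :
  (forall i, (n <= i)%N -> iter i fdiff f u = 0) ->
  f (u + Posz w) = \sum_(i < n) iter i fdiff f u *+ 'C(w, i).
Proof.
move=> fn; rewrite newton.
transitivity (\sum_(i < maxn n w.+1) iter i fdiff f u *+ 'C(w, i)).
  rewrite (big_ord_widen (maxn n w.+1) (fun i => iter i fdiff f u *+ 'C(w, i)));
    last by rewrite leq_maxr.
  rewrite [LHS]big_mkcond; apply: eq_bigr => i _.
  by case: ltnP => // wi; rewrite bin_small.
rewrite [RHS](big_ord_widen (maxn n w.+1)
  (fun i => iter i fdiff f u *+ 'C(w, i))); last by rewrite leq_maxl.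
rewrite [RHS]big_mkcond; apply: eq_bigr => i _.
by case: ltnP => // /fn ->; rewrite mul0rn.
Qed.

End ForwardDifference.

Lemma iter_fdiff_sum (R : pzRingType) (I : Type) (s : seq I) (q : I -> R)
    (f : I -> int -> R) i z :
  iter i (@fdiff R) (fun z => \sum_(t <- s) q t * f t z) z =
  \sum_(t <- s) q t * iter i (@fdiff R) (f t) z.
Proof.
elim: i z => //= i IH z; rewrite /fdiff !IH -sumrB.
by apply: eq_bigr => t _; rewrite mulrBr.
Qed.

Lemma iter_fdiff_intr (R : pzRingType) (f : int -> int) i z :
  iter i (@fdiff R) (fun z => (f z)%:~R) z = (iter i (@fdiff int) f z)%:~R.
Proof. by elim: i z => //= i IH z; rewrite /fdiff !IH rmorphB. Qed.

Lemma iter_fdiff0 (V : zmodType) i z : iter i (@fdiff V) (fun _ => 0) z = 0.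
Proof. by elim: i z => //= i IH z; rewrite /fdiff !IH subrr. Qed.

(** The forward difference of 1/(1-t)^(n+1) has coefficients z |-> geom n (z+1);
    hence n differences annihilate [geom n] above 0. *)
Lemma iter_fdiff_geom i n z : (i <= n)%N ->
  iter i (@fdiff int) (geom n) z = geom (n - i) (z + Posz i).
Proof.
elim: i z => [|i IH] z ni; first by rewrite subn0 addr0.
rewrite /= /fdiff !IH 1?ltnW // -[RHS]geomB subnSK //.
by congr (geom _ _ - geom _ _); lia.
Qed.

Lemma iter_fdiff_geom_eq0 i n c z : c < z -> (n <= i)%N ->
  iter i (@fdiff int) (fun z => geom n (z - c)) z = 0.
Proof.
move=> cz ni; rewrite -(subnK ni) iterD.
rewrite (@eq_iter_fdiff _ _ _ (fun _ => 0) (c + 1)) ?iter_fdiff0 //; last lia.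
move=> {cz}z cz; rewrite (iter_fdiff_shift _ (geom n)).
rewrite iter_fdiff_geom // subnn geom0; lia.
Qed.

(** * Polynomials with positive leading coefficient *)

Definition eventually (P : int -> Prop) : Prop :=
  exists U : int, forall z, U <= z -> P z.

Lemma eventually_gt U : eventually (fun z => U < z).
Proof. by exists (U + 1) => z; lia. Qed.

Lemma eventually_and P Q :
  eventually P -> eventually Q -> eventually (fun z => P z /\ Q z).
Proof.
move=> [U HU] [V HV]; exists (Num.max U V) => z.
by rewrite ge_max => /andP[/HU ? /HV].
Qed.

Lemma eventually_all (T : eqType) (s : seq T) (P : T -> int -> Prop) :
  (forall t, t \in s -> eventually (P t)) ->
  eventually (fun z => forall t, t \in s -> P t z).
Proof.
elim: s => [|t s IH] ev; first by exists 0.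
have [|U HU] := IH; first by move=> x xs; apply: ev; rewrite inE xs orbT.
have [|V HV] := ev t; first by rewrite mem_head.
exists (Num.max U V) => z; rewrite ge_max => /andP[/HU Hs /HV Ht] x.
by rewrite inE => /orP[/eqP ->|/Hs].
Qed.

Lemma eventually_lt (n : nat) (P : nat -> int -> Prop) :
  (forall i, (i < n)%N -> eventually (P i)) ->
  eventually (fun z => forall i, (i < n)%N -> P i z).
Proof.
move=> ev; have [|U HU] := @eventually_all _ (iota 0 n) P.
  by move=> i; rewrite mem_iota => /ev.
by exists U => z /HU H i ilt; apply: H; rewrite mem_iota.
Qed.

(** Degree [d] and positive leading coefficient, expressed through the
    coefficient at [d] so that sums and products are handled without computing
    sizes exactly. *)
Definition pdeg (d : nat) (p : {poly rat}) : bool :=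
  (size p <= d.+1)%N && (0 < p`_d).

(** Write p = X q + p(0): for large x the term x q(x) outgrows |p(0)|, but only if
    q is bounded away from 0. This is why the induction carries a positive lower
    bound and not just positivity. *)
Lemma pdeg_bounded_below d p : pdeg d p ->
  exists2 e : rat, 0 < e & exists U : rat, forall x, U <= x -> e <= p.[x].
Proof.
elim: d p => [|d IH] p /andP[sp pd].
  exists p`_0 => //; exists 0 => x _.
  by rewrite [in leRHS](size1_polyC sp) hornerC.
pose q := \poly_(i < d.+1) p`_i.+1.
have pE : p = q * 'X + (p`_0)%:P.
  apply/polyP => i; rewrite coefD coefMX coefC coef_poly.
  case: i => [|i] /=; rewrite ?add0r ?addr0 //.
  by case: ltnP => // di; rewrite nth_default // (leq_trans sp).
have [|e e0 [U HU]] := IH q.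
  by rewrite /pdeg size_poly coef_poly ltnSn.
exists e => //; exists (Num.max U (Num.max 0 ((e - p`_0) / e))) => x.
rewrite !ge_max => /and3P[/HU qx x0 ex].
rewrite pE !hornerE -[leLHS](subrK p`_0) lerD2r.
rewrite ler_pdivrMr // in ex; apply: le_trans ex _.
by rewrite mulrC ler_wpM2r.
Qed.

Lemma pdeg_eventually d p : pdeg d p -> eventually (fun z => 0 < p.[z%:~R]).
Proof.
move=> /pdeg_bounded_below[e e0 [U HU]].
exists (Num.bound `|U|) => z Uz; apply: lt_le_trans e0 (HU _ _).
apply: le_trans (ler_norm _) _; apply/ltW.
apply: lt_le_trans (archi_boundP (normr_ge0 U)) _.
by rewrite -[leLHS]/((Num.bound `|U|)%:Z%:~R) ler_int.
Qed.

Lemma pdegM d e p q : pdeg d p -> pdeg e q -> pdeg (d + e) (p * q).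
Proof.
move=> /andP[sp pd] /andP[sq qe]; apply/andP; split.
  by apply: leq_trans (size_polyMleq _ _) _; lia.
suff -> : (p * q)`_(d + e) = p`_d * q`_e by rewrite mulr_gt0.
have dl : (d < (d + e).+1)%N by rewrite ltnS leq_addr.
rewrite coefM (bigD1 (Ordinal dl)) //= addKn big1 ?addr0 // => i id.
rewrite -val_eqE neq_ltn /= in id; case/orP: id => id.
  by rewrite [q`__]nth_default ?mulr0 //; apply: leq_trans sq _; lia.
by rewrite [p`__]nth_default ?mul0r //; apply: leq_trans sp _; lia.
Qed.

Lemma pdegZ c d p : 0 < c -> pdeg d p -> pdeg d (c *: p).
Proof.
move=> c0 /andP[sp pd]; rewrite /pdeg coefZ mulr_gt0 // andbT.
exact: leq_trans (size_scale_leq _ _) sp.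
Qed.

Lemma pdeg_lead p : p != 0 -> 0 < lead_coef p -> pdeg (size p).-1 p.
Proof. by move=> p0 lp; rewrite /pdeg prednK ?leqnn // size_poly_gt0. Qed.

(** The polynomial counterpart of [fdiff]. *)
Definition dpoly (p : {poly rat}) : {poly rat} := p \Po ('X + 1) - p.

Lemma horner_dpoly p x : (dpoly p).[x] = p.[x + 1] - p.[x].
Proof. by rewrite /dpoly !hornerE horner_comp !hornerE. Qed.

Lemma coef_Xadd1 i e : (('X + 1 : {poly rat}) ^+ i)`_e = 'C(i, e)%:R.
Proof.
rewrite addrC exprDn coef_sum.
under eq_bigr do rewrite expr1n mul1r coefMn coefXn.
case: (leqP e i) => ei; last first.
  rewrite bin_small // big1 // => j _; case: eqP => [ej|]; last by rewrite mul0rn.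
  by have := ltn_ord j; lia.
rewrite (bigD1 (inord e : 'I_i.+1)) //= inordK // eqxx big1 ?addr0 // => j.
by rewrite -val_eqE /= inordK // eq_sym => /negbTE ->; rewrite mul0rn.
Qed.

Lemma coef_dpoly d (p : {poly rat}) e : (size p <= d)%N ->
  (dpoly p)`_e = \sum_(i < d) p`_i * 'C(i, e)%:R - p`_e.
Proof.
move=> sp; rewrite coefB coef_comp_poly; congr (_ - _).
rewrite (big_ord_widen d (fun i => p`_i * (('X + 1) ^+ i)`_e)) //.
rewrite big_mkcond; apply: eq_bigr => i _; rewrite coef_Xadd1.
by case: ltnP => // pi; rewrite nth_default ?mul0r.
Qed.

(** By the binomial theorem the leading coefficient p_(d+1) gives
    (d+1) p_(d+1) in degree [d], and nothing survives above. *)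
Lemma pdeg_dpoly d p : pdeg d.+1 p -> pdeg d (dpoly p).
Proof.
move=> /andP[sp pd]; apply/andP; split.
  apply/leq_sizeP => e de; rewrite (coef_dpoly _ sp) big_ord_recr /=.
  rewrite big1 ?add0r; last first.
    move=> i _; rewrite bin_small ?mulr0 //; exact: leq_trans (ltn_ord i) de.
  case: (ltngtP d.+1 e) => [lt||<-]; last by rewrite binn mulr1 subrr.
    by rewrite bin_small // mulr0 sub0r nth_default ?oppr0 // (leq_trans sp).
  by rewrite ltnNge de.
rewrite (coef_dpoly _ sp) !big_ord_recr /= big1; last first.
  by move=> i _; rewrite bin_small ?mulr0.
rewrite add0r binn mulr1 addrAC subrr add0r mulr_gt0 //.
by rewrite ltr0n bin_gt0.
Qed.

Lemma dpoly_const (p : {poly rat}) : (size p <= 1)%N -> dpoly p = 0.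
Proof. by move=> /size1_polyC ->; rewrite /dpoly comp_polyC subrr. Qed.

Lemma dpoly0 : dpoly 0 = 0.
Proof. by rewrite dpoly_const ?size_poly0. Qed.

Lemma pdeg_iter_dpoly i d p : pdeg d p -> (i <= d)%N ->
  pdeg (d - i) (iter i dpoly p).
Proof.
move=> dp; elim: i => [|i IH] id; first by rewrite subn0.
by rewrite iterS; apply: pdeg_dpoly; rewrite subnSK // IH // ltnW.
Qed.

Lemma iter_dpoly_eq0 i d p : pdeg d p -> (d < i)%N -> iter i dpoly p = 0.
Proof.
move=> dp di; rewrite -(subnK di) iterD.
have -> : iter d.+1 dpoly p = 0.
  rewrite iterS dpoly_const //.
  by have := pdeg_iter_dpoly dp (leqnn d); rewrite subnn => /andP[].
by elim: (_ - _)%N => //= k ->; rewrite dpoly0.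
Qed.

Lemma iter_fdiff_horner i p z :
  iter i (@fdiff rat) (fun z => p.[z%:~R]) z = (iter i dpoly p).[z%:~R].
Proof.
elim: i z => //= i IH z; rewrite /fdiff !IH horner_dpoly.
by rewrite intrD.
Qed.

(** The leading coefficient of [p] cannot be negative, and a positive leading
    coefficient is inherited by differences until they vanish. *)
Lemma eventually_iter_dpoly i p : eventually (fun z => 0 <= p.[z%:~R]) ->
  eventually (fun z => 0 <= (iter i dpoly p).[z%:~R]).
Proof.
have [->|p0] := eqVneq p 0.
  move=> _; exists 0 => z _; suff -> : iter i dpoly 0 = 0 by rewrite horner0.
  by elim: i => //= i ->; rewrite dpoly0.
have [lp|lp|/eqP] := ltgtP (lead_coef p) 0; last by rewrite lead_coef_eq0 (negbTE p0).
  move=> [U HU].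
  have [|V HV] := @pdeg_eventually (size (- p)).-1 (- p).
    by apply: pdeg_lead; rewrite ?oppr_eq0 // lead_coefN oppr_gt0.
  have := HU (Num.max U V); have := HV (Num.max U V).
  rewrite !le_max !lexx !orbT hornerN oppr_gt0 => /(_ isT) h /(_ isT).
  by rewrite leNgt h.
move=> _; have dp := pdeg_lead p0 lp.
have [id|di] := leqP i (size p).-1.
  have [U HU] := pdeg_eventually (pdeg_iter_dpoly dp id).
  by exists U => z /HU /ltW.
by exists 0 => z _; rewrite (iter_dpoly_eq0 dp) // horner0.
Qed.

(** * Interpolating polynomials *)

(** The polynomial binomial(z - c + k, k) for i = k+1, which agrees with the
    coefficients of t^c/(1-t)^i beyond [c]; for i = 0 the series is t^c and the
    polynomial is 0. *)
Definition hpoly (i : nat) (c : int) : {poly rat} :=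
  if i is k.+1
  then (k`!%:R)^-1 *: \prod_(s < k) ('X - (c%:~R - s.+1%:R)%:P)
  else 0.

Lemma pdeg_hpoly k c : pdeg k (hpoly k.+1 c).
Proof.
apply: pdegZ; first by rewrite invr_gt0 ltr0n fact_gt0.
set p := \prod_(_ < _) _.
have sp : size p = k.+1.
  rewrite size_prod_XsubC [index_enum _]unlock.
  by rewrite -enumT size_enum_ord.
have /monicP : p \is monic by apply: monic_prod_XsubC.
by rewrite /lead_coef /pdeg sp => ->; rewrite leqnn ltr01.
Qed.

Lemma horner_hpoly i c z : c < z -> (geom i (z - c))%:~R = (hpoly i c).[z%:~R].
Proof.
move=> cz; case: i => [|k]; first by rewrite geom0 horner0 subr_eq0 gt_eqF.
have [w zE] : exists w : nat, z = c + Posz w by exists (absz (z - c)); lia.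
rewrite zE addrAC subrr add0r hornerZ horner_prod.
have -> : geom k.+1 (Posz w) = 'C(w + k, k).
  by rewrite -geomS; congr (geom _ _); lia.
apply: (@mulfI _ k`!%:R); first by rewrite pnatr_eq0 -lt0n fact_gt0.
rewrite mulVKf; last by rewrite pnatr_eq0 -lt0n fact_gt0.
rewrite -[_%:~R]/(_%:R) -natrM mulnC bin_ffact.
elim: k => [|k IH]; first by rewrite big_ord0 ffactn0.
rewrite big_ord_recr /= -IH addnS ffactSS natrM mulrC; congr (_ * _).
rewrite !hornerE intrD -[(Posz w)%:~R]/(w%:R) -addnS natrD; ring.
Qed.

(** * Cells *)

(** The coefficients of t^c/((1-t1)^i (1-t2)^j), for t = ((i, j), c). *)
Definition cell (t : (nat * nat) * (int * int)) (a : int * int) : int :=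
  geom t.1.1 (a.1 - t.2.1) * geom t.1.2 (a.2 - t.2.2).

Definition decomposable (m n : nat) (H : int * int -> int) : Prop :=
  exists2 l : seq ((nat * nat) * (int * int)),
    all (fun t => (t.1.1 <= m)%N && (t.1.2 <= n)%N) l
    & forall a, H a = \sum_(t <- l) cell t a.

Lemma seq_argmax (T : eqType) (s : seq T) (f : T -> nat) x0 : x0 \in s ->
  exists2 x, x \in s & forall y, y \in s -> (f y <= f x)%N.
Proof.
elim: s x0 => // y [|z s] IH x0 _.
  by exists y; rewrite ?mem_head // => x; rewrite inE => /eqP ->.
have [x xs xmax] := IH z (mem_head _ _).
have [yx|xy] := leqP (f y) (f x).
  exists x; first by rewrite inE xs orbT.
  by move=> w; rewrite inE => /orP[/eqP ->|/xmax].
exists y; first by rewrite mem_head.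
move=> w; rewrite inE => /orP[/eqP -> //|/xmax wx].
exact: leq_trans wx (ltnW xy).
Qed.

(** * Clearing denominators *)

(** A sum over a fixed finite range of exponents, unlike one over the support of
    [q], is visibly additive in [q]. *)
Lemma mul_series_wE H q a k : (msize q <= k)%N ->
  mul_series H q a = \sum_(m : 'X_{1..2 < k}) q@_m * H (a - mnm2 m).
Proof.
move=> le_qk; pose I : subFinType _ := 'X_{1..2 < k}.
rewrite /mul_series (big_mksub I) ?msupp_uniq //=; first last.
  by move=> x /msize_mdeg_lt /leq_trans; apply.
by rewrite big_rmcond //= => j /memN_msupp_eq0 ->; rewrite mul0r.
Qed.

Lemma mul_seriesB H p q a :
  mul_series H (p - q) a = mul_series H p a - mul_series H q a.
Proof.
pose k := maxn (msize (p - q)) (maxn (msize p) (msize q)).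
rewrite !(@mul_series_wE _ _ _ k) ?leq_max ?leqnn ?orbT // -sumrB.
by apply: eq_bigr => m _; rewrite mcoeffB mulrBl.
Qed.

Lemma mnm2D k l : mnm2 (k + l)%MM = mnm2 k + mnm2 l.
Proof. by rewrite /mnm2 !mnmDE !PoszD. Qed.

Lemma mul_seriesMX H q m a :
  mul_series H (q * 'X_[m]) a = mul_series H q (a - mnm2 m).
Proof.
rewrite /mul_series (perm_big _ (msuppMX _ _)) big_map.
by apply: eq_bigr => k _; rewrite mcoeffMX mnm2D opprD addrA.
Qed.

Definition nabla1 (F : int * int -> int) (a : int * int) : int :=
  F a - F (a - (1, 0)).
Definition nabla2 (F : int * int -> int) (a : int * int) : int :=
  F a - F (a - (0, 1)).

Lemma eq_nabla1 k F F' : F =1 F' -> iter k nabla1 F =1 iter k nabla1 F'.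
Proof. by move=> E; elim: k => //= k IH a; rewrite /nabla1 !IH. Qed.

Lemma eq_nabla2 k F F' : F =1 F' -> iter k nabla2 F =1 iter k nabla2 F'.
Proof. by move=> E; elim: k => //= k IH a; rewrite /nabla2 !IH. Qed.

Lemma mul_series_denom H d1 d2 :
  mul_series H (denom d1 d2) =1 iter d1 nabla1 (iter d2 nabla2 H).
Proof.
have E0 : mnm2 U_(ord0) = (1, 0) by rewrite /mnm2 !mnm1E.
have E1 : mnm2 U_(ord_max) = (0, 1) by rewrite /mnm2 !mnm1E.
rewrite /denom mulrC; elim: d1 => [|d1 IH] a.
  rewrite expr0 mulr1; elim: d2 a => [|d2 IH] a.
    rewrite /mul_series expr0 msupp1 big_seq1 mcoeff1 eqxx mul1r.
    by rewrite /mnm2 !mnm0E [a - _]subr0.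
  by rewrite exprSr mulrBr mulr1 mul_seriesB mul_seriesMX !IH E1.
by rewrite exprSr mulrA mulrBr mulr1 mul_seriesB mul_seriesMX !IH E0.
Qed.

(** On a product of functions of one variable each the two operators act
    separately, which reduces statements on cells to one variable. *)
Lemma iter_nabla_prod d1 d2 (f g : int -> int) a :
  iter d1 nabla1 (iter d2 nabla2 (fun a => f a.1 * g a.2)) a =
  iter d1 nabla f a.1 * iter d2 nabla g a.2.
Proof.
elim: d1 a => [|d1 IH] a.
  rewrite /=; elim: d2 a => [|d2 IH] a //=.
  by rewrite /nabla2 !IH /= subr0 -mulrBr.
by rewrite /= /nabla1 !IH /= subr0 -mulrBl.
Qed.

Lemma iter_nabla_sum (T : Type) (s : seq T) (q : T -> int) F d1 d2 a :
  iter d1 nabla1 (iter d2 nabla2 (fun a => \sum_(t <- s) q t * F t a)) a =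
  \sum_(t <- s) q t * iter d1 nabla1 (iter d2 nabla2 (F t)) a.
Proof.
elim: d1 a => [|d1 IH] a.
  rewrite /=; elim: d2 a => [|d2 IH] a //=.
  rewrite /nabla2 !IH -sumrB.
  by apply: eq_bigr => t _; rewrite mulrBr.
rewrite /= /nabla1 !IH -sumrB.
by apply: eq_bigr => t _; rewrite mulrBr.
Qed.

Lemma iter_nablaB F F' d1 d2 a :
  iter d1 nabla1 (iter d2 nabla2 (fun a => F a - F' a)) a =
  iter d1 nabla1 (iter d2 nabla2 F) a - iter d1 nabla1 (iter d2 nabla2 F') a.
Proof.
elim: d1 a => [|d1 IH] a.
  rewrite /=; elim: d2 a => [|d2 IH] a //=.
  by rewrite /nabla2 !IH; ring.
by rewrite /= /nabla1 !IH; ring.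
Qed.

Lemma laurent_polynomial_sum (l : seq ((nat * nat) * (int * int)))
    (F : (nat * nat) * (int * int) -> int * int -> int) :
  (forall t, t \in l -> laurent_polynomial (F t)) ->
  laurent_polynomial (fun a => \sum_(t <- l) F t a).
Proof.
elim: l => [|t l IH] lF; first by exists [::] => a; rewrite big_nil eqxx.
have [|s Hs] := IH; first by move=> x xl; apply: lF; rewrite inE xl orbT.
have [s' Hs'] := lF t (mem_head _ _).
exists (s' ++ s) => a; rewrite big_cons mem_cat.
have [->|/Hs' -> //] := eqVneq (F t a) 0.
by rewrite add0r => /Hs ->; rewrite orbT.
Qed.

(** One factor 1 - t1 or 1 - t2 at a time, the denominator of each cell is
    cancelled; the remaining factors keep the support finite. *)
Lemma decomposable_laurent m n H : decomposable m n H ->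
  laurent_polynomial (mul_series H (denom m n)).
Proof.
move=> [l /allP lmn HE].
have [|s Hs] := @laurent_polynomial_sum l
    (fun t => iter m nabla1 (iter n nabla2 (cell t))).
  move=> [[i j] [c d]] /lmn /= /andP[im jn].
  have [s1 Hs1] := iter_nabla_geom_fin c im.
  have [s2 Hs2] := iter_nabla_geom_fin d jn.
  exists [seq (x, y) | x <- s1, y <- s2] => -[x y].
  rewrite (iter_nabla_prod _ _ (fun z => geom i (z - c)) (fun z => geom j (z - d))).
  rewrite mulf_eq0 negb_or => /andP[/Hs1 xs /Hs2 ys].
  exact: allpairs_f.
exists s => a ha; apply: Hs; apply: contraNneq ha => <-.
rewrite mul_series_denom (eq_nabla1 _ (eq_nabla2 n HE)).
have E : iter n nabla2 (fun a => \sum_(t <- l) cell t a) =1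
    iter n nabla2 (fun a => \sum_(t <- l) 1 * cell t a).
  by apply: eq_nabla2 => b; apply: eq_bigr => t _; rewrite mul1r.
rewrite (eq_nabla1 _ E) iter_nabla_sum.
by apply/eqP; apply: eq_bigr => t _; rewrite mul1r.
Qed.

Lemma laurent_series_nabla1 F : laurent_series F -> laurent_series (nabla1 F).
Proof.
move=> [b Hb]; exists b => a ba; rewrite /nabla1 !Hb ?subrr //.
by move: ba; rewrite /le2 /=; lia.
Qed.

Lemma laurent_series_nabla2 F : laurent_series F -> laurent_series (nabla2 F).
Proof.
move=> [b Hb]; exists b => a ba; rewrite /nabla2 !Hb ?subrr //.
by move: ba; rewrite /le2 /=; lia.
Qed.

(** Multiplication by 1 - t1 is injective on series bounded below: if the product
    vanishes then [F] is constant along rows, and it is zero far to the left. *)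
Lemma nabla1_eq0 F : laurent_series F -> nabla1 F =1 (fun=> 0) ->
  F =1 (fun=> 0).
Proof.
move=> [b Hb] F0 [x y].
have Fk k : F (x, y) = F (x - Posz k, y).
  elim: k => [|k ->]; first by rewrite subr0.
  have /eqP := F0 (x - Posz k, y); rewrite subr_eq0 => /eqP ->.
  by congr F; congr (_, _) => /=; lia.
rewrite (Fk `|x - b.1|.+1) Hb // /le2 /=; lia.
Qed.

Lemma nabla2_eq0 F : laurent_series F -> nabla2 F =1 (fun=> 0) ->
  F =1 (fun=> 0).
Proof.
move=> [b Hb] F0 [x y].
have Fk k : F (x, y) = F (x, y - Posz k).
  elim: k => [|k ->]; first by rewrite subr0.
  have /eqP := F0 (x, y - Posz k); rewrite subr_eq0 => /eqP ->.
  by congr F; congr (_, _) => /=; lia.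
rewrite (Fk `|y - b.2|.+1) Hb // /le2 /=; lia.
Qed.

Lemma iter_nabla_eq0 d1 d2 F : laurent_series F ->
  iter d1 nabla1 (iter d2 nabla2 F) =1 (fun=> 0) -> F =1 (fun=> 0).
Proof.
move=> lF; elim: d1 => [|d1 IH].
  elim: d2 => //= d2 IH E; apply: IH; apply: nabla2_eq0 E.
  by elim: d2 => //= d2 /laurent_series_nabla2.
move=> E; apply: IH; apply: nabla1_eq0 E.
elim: d1 => [|d1] /=; last exact: laurent_series_nabla1.
by elim: d2 => //= d2 /laurent_series_nabla2.
Qed.

Lemma laurent_series_cells (T : Type) (s : seq T) (q : T -> int) f :
  laurent_series (fun a => \sum_(t <- s) q t * cell (f t) a).
Proof.
elim: s => [|t s [b Hb]]; first by exists 0 => a _; rewrite big_nil.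
exists (Num.min b.1 (f t).2.1, Num.min b.2 (f t).2.2) => a.
rewrite /le2 /= !ge_min => ba; rewrite big_cons Hb /le2 ?addr0; last lia.
suff -> : cell (f t) a = 0 by rewrite mulr0.
rewrite /cell; have [ac|ac] := ltP a.1 (f t).2.1.
  by rewrite geom_neg ?mul0r //; lia.
by rewrite [geom _ (a.2 - _)]geom_neg ?mulr0 //; lia.
Qed.

(** With Q the numerator of [H], the sum of Q_c t^c/((1-t1)^m (1-t2)^n) has the
    same numerator as [H] and is bounded below, so it is [H]. The coefficients Q_c
    have arbitrary signs. *)
Lemma laurent_cells m n H : laurent_series H ->
  laurent_polynomial (mul_series H (denom m n)) ->
  exists (s : seq (int * int)) (Q : int * int -> int),
    forall a, H a = \sum_(c <- s) Q c * cell ((m, n), c) a.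
Proof.
move=> lH [s0 Hs0]; pose s := undup s0.
pose Q a := mul_series H (denom m n) a; exists s, Q => a.
apply/eqP; rewrite -subr_eq0; apply/eqP.
pose F a := \sum_(c <- s) Q c * cell ((m, n), c) a.
apply: (@iter_nabla_eq0 m n (fun a => H a - F a)) => [|{}a].
  have [b Hb] := lH.
  have [b' Hb'] := @laurent_series_cells _ s Q (fun c => ((m, n), c)).
  exists (Num.min b.1 b'.1, Num.min b.2 b'.2) => {}a.
  by rewrite /le2 /= !ge_min => ba; rewrite Hb ?[F a]Hb' ?subr0 // /le2; lia.
rewrite iter_nablaB -mul_series_denom iter_nabla_sum.
rewrite (eq_bigr (fun c => Q c * Posz (a == c))); last first.
  move=> c _; congr (_ * _).
  rewrite (iter_nabla_prod _ _ (fun z => geom m (z - c.1))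
    (fun z => geom n (z - c.2))) !iter_nabla_geom.
  by case: a c => [x y] [x' y'] /=; rewrite xpair_eqE; do 2!case: (_ == _).
rewrite -/(Q a); have [as0|as0] := boolP (a \in s).
  rewrite (bigD1_seq a) ?undup_uniq //= eqxx mulr1 big1 ?addr0 ?subrr //.
  by move=> c; rewrite eq_sym => /negbTE ->; rewrite mulr0.
have -> : Q a = 0.
  by apply/eqP; apply: contraNT as0 => /Hs0; rewrite mem_undup.
rewrite sub0r big_seq big1 ?oppr0 // => c cs.
by case: eqP cs as0 => [->|]; rewrite ?mulr0 // => ->.
Qed.

(** * Hilbert polynomials of combinations of cells *)

Definition mn (i j : nat) : 'X_{1..2} :=
  [multinom (if k == ord0 then i else j) | k < 2].

Lemma mnE (k : 'X_{1..2}) : k = mn (k ord0) (k ord_max).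
Proof.
apply/mnmP => i; rewrite mnmE; case: eqP => [-> //|/eqP i0].
by congr (k _); apply: val_inj; case: i i0 => [[|[]]].
Qed.

Lemma mn0 i j : mn i j ord0 = i. Proof. by rewrite mnmE. Qed.
Lemma mn1 i j : mn i j ord_max = j. Proof. by rewrite mnmE. Qed.

Lemma mn_eq i j k : (mn i j == k) = (i == k ord0) && (j == k ord_max).
Proof.
apply/eqP/andP => [<-|[/eqP -> /eqP ->]]; first by rewrite mn0 mn1.
by rewrite -mnE.
Qed.

Definition tensor (p q : {poly rat}) : {mpoly rat[2]} :=
  \sum_(i < size p) \sum_(j < size q) (p`_i * q`_j) *: 'X_[mn i j].

Lemma mcoeff_tensor p q k : (tensor p q)@_k = p`_(k ord0) * q`_(k ord_max).
Proof.
rewrite raddf_sum /=.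
transitivity ((\sum_(i < size p) p`_i * (i == k ord0 :> nat)%:R) *
  (\sum_(j < size q) q`_j * (j == k ord_max :> nat)%:R)).
  rewrite mulr_suml; apply: eq_bigr => i _; rewrite raddf_sum mulr_sumr /=.
  apply: eq_bigr => j _; rewrite mcoeffZ mcoeffX mn_eq mulrACA -natrM.
  by rewrite mulnb.
suff E (r : {poly rat}) e :
    \sum_(i < size r) r`_i * (i == e :> nat)%:R = r`_e by rewrite !E.
have [re|er] := leqP (size r) e.
  rewrite nth_default // big1 // => i _; case: eqP => [ie|]; rewrite ?mulr0 //.
  by have := ltn_ord i; rewrite ie ltnNge re.
rewrite (bigD1 (Ordinal er)) //= eqxx mulr1 big1 ?addr0 // => i.
by rewrite -val_eqE /= => /negbTE ->; rewrite mulr0.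
Qed.

Lemma meval_tensor p q a : (tensor p q).@[point2 a] = p.[a.1%:~R] * q.[a.2%:~R].
Proof.
rewrite !horner_coef mulr_suml raddf_sum; apply: eq_bigr => i _.
rewrite mulr_sumr raddf_sum; apply: eq_bigr => j _ /=.
rewrite mevalZ mevalX big_ord_recl big_ord1 /=.
have -> : lift ord0 ord0 = ord_max :> 'I_2 by apply: val_inj.
by rewrite mn0 mn1 mulrACA.
Qed.

Definition cell_poly (t : (nat * nat) * (int * int)) : {mpoly rat[2]} :=
  tensor (hpoly t.1.1 t.2.1) (hpoly t.1.2 t.2.2).

(** Beyond all the corners of the cells every factor [geom] agrees with its
    interpolating polynomial. *)
Lemma is_hilbert_poly_cells (T : eqType) (s : seq T) (q : T -> int) f H :
  (forall a, H a = \sum_(t <- s) q t * cell (f t) a) ->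
  is_hilbert_poly H (\sum_(t <- s) (q t)%:~R *: cell_poly (f t)).
Proof.
move=> HE; have [|U HU] := @eventually_all T s
    (fun t z => (f t).2.1 < z /\ (f t).2.2 < z).
  by move=> t _; apply: eventually_and; apply: eventually_gt.
exists (U, U) => a /andP[/= /HU U1 /HU U2].
rewrite HE raddf_sum raddf_sum /= [LHS]big_seq [RHS]big_seq.
apply: eq_bigr => t ts; rewrite mevalZ meval_tensor intrM; congr (_ * _).
have [c1 _] := U1 _ ts; have [_ c2] := U2 _ ts.
by rewrite -!horner_hpoly // -intrM.
Qed.

Lemma cell_poly_neq0 t k : (cell_poly t)@_k != 0 ->
  (k ord0 < t.1.1)%N && (k ord_max < t.1.2)%N.
Proof.
suff E i c e : (hpoly i c)`_e != 0 -> (e < i)%N.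
  by rewrite mcoeff_tensor mulf_eq0 negb_or => /andP[/E -> /E ->].
case: i => [|i]; first by rewrite coef0 eqxx.
have /andP[sp _] := pdeg_hpoly i c.
by apply: contraNT; rewrite -leqNgt => ie; rewrite nth_default // (leq_trans sp).
Qed.

Lemma cell_poly_top i j c : 0 < (cell_poly ((i.+1, j.+1), c))@_(mn i j).
Proof.
rewrite mcoeff_tensor mn0 mn1; have /andP[_ pi] := pdeg_hpoly i c.1.
by have /andP[_ pj] := pdeg_hpoly j c.2; apply: mulr_gt0.
Qed.

(** In the polynomial of a cell with denominator exponents (i+1, j+1) every
    monomial divides the top one z1^i z2^j, whose coefficient is positive. If a
    monomial [k] appears in the sum, pick among the cells involving it one with
    maximal top; no cell contributes negatively at this top, so it appears in the
    sum and is divisible by [k]. An extremal [k] is therefore itself such a top. *)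
Lemma decomposable_extremal m n H : decomposable m n H ->
  positive_extremal_coefs (hilbert_poly H).
Proof.
move=> [l _ HE].
have HP : is_hilbert_poly H (\sum_(t <- l) cell_poly t).
  rewrite (eq_bigr (fun t => (1 : int)%:~R *: cell_poly t)); last first.
    by move=> t _; rewrite scale1r.
  apply: (is_hilbert_poly_cells (f := id)) => a; rewrite HE.
  by apply: eq_bigr => t _; rewrite mul1r.
rewrite (is_hilbert_poly_uniq (hilbert_polyP (ex_intro _ _ HP)) HP).
set P := \sum_(t <- l) _ => k [kP kext].
pose l' := [seq t <- l | (k ord0 < t.1.1)%N && (k ord_max < t.1.2)%N].
have [t0 t0l'] : exists t, t \in l'.
  have /hasP[t tl tk] : has (fun t => (cell_poly t)@_k != 0) l.
    apply: contraLR kP => /hasPn l0; rewrite mcoeff_msupp negbK raddf_sum /=.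
    by rewrite big_seq big1 // => t /l0; rewrite negbK => /eqP.
  by exists t; rewrite mem_filter tl cell_poly_neq0.
have [[[i j] c] tl' tmax] := seq_argmax (fun t => t.1.1 + t.1.2)%N t0l'.
move: (tl'); rewrite mem_filter /= => /andP[/andP[ki kj] tl].
case: i j ki kj tl' tmax tl => [|i] [|j] // ki kj tl' tmax tl.
(* A cell that contributes at the chosen top has a larger or equal top, hence the
   same one by maximality. *)
have P_gt0 : 0 < P@_(mn i j).
  rewrite raddf_sum (big_rem _ tl) /= ltr_pwDl ?cell_poly_top //.
  rewrite big_seq sumr_ge0 // => -[[i' j'] c'] /mem_rem tl2.
  have [->//|nz] := eqVneq (cell_poly ((i', j'), c'))@_(mn i j) 0.
  have := cell_poly_neq0 nz; rewrite mn0 mn1 /= => /andP[ii jj].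
  have := tmax ((i', j'), c'); rewrite mem_filter tl2 /= => /(_ _) h.
  have h' : (i' + j' <= i.+1 + j.+1)%N by apply: h; rewrite andbT; lia.
  have -> : i' = i.+1 by lia.
  have -> : j' = j.+1 by lia.
  exact/ltW/cell_poly_top.
have [-> // | nk] := eqVneq k (mn i j).
have := kext (mn i j); rewrite mcoeff_msupp gt_eqF // eq_sym nk => /(_ isT isT).
case/negP; apply/mnm_lepP => e; rewrite [k]mnE !mnmE.
by case: ifP.
Qed.

Lemma decomposable_ge0 m n H : decomposable m n H -> nonneg_series H.
Proof.
move=> [l _ HE] a; rewrite HE sumr_ge0 // => t _.
by rewrite mulr_ge0 ?geom_ge0.
Qed.

(** * Nonnegative functions of one variable *)

(** Nonnegative integer multiples are obtained by repetition, so that a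
    decomposition needs no coefficients. *)
Lemma nonneg_comb (T A : Type) (F : T -> A -> int) (P : pred T)
    (s : seq (int * T)) :
  all (fun x => (0 <= x.1) && P x.2) s ->
  exists2 l : seq T, all P l
    & forall a, \sum_(x <- s) x.1 * F x.2 a = \sum_(t <- l) F t a.
Proof.
elim: s => [|[c t] s IH] /=; first by exists [::] => // a; rewrite !big_nil.
case/andP=> /andP[c0 Pt] /IH[l lP lE]; exists (nseq `|c| t ++ l).
  by rewrite all_cat lP andbT all_nseq Pt orbT.
move=> a; rewrite big_cons big_cat lE /=; congr (_ + _).
rewrite big_nseq iter_addr_0 -mulr_natl; congr (_ * _).
by case: c c0 => // k _; rewrite natz.
Qed.

Definition decomposable1 (n : nat) (g : int -> int) : Prop :=
  exists2 l : seq (nat * int), all (fun t => (t.1 <= n)%N) l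
    & forall z, g z = \sum_(t <- l) geom t.1 (z - t.2).

Lemma sum_iota_delta (f : int -> int) (U : int) (N : nat) z :
  \sum_(k <- iota 0 N) (z == U + Posz k)%:R * f (U + Posz k) =
  if (U <= z) && (z < U + Posz N) then f z else 0.
Proof.
elim: N => [|N IH]; first by rewrite big_nil; case: ifP => //; lia.
rewrite -[N.+1]addn1 iotaD big_cat big_seq1 IH add0n /=.
case: eqP => [->|zN]; last first.
  by rewrite mul0r addr0; congr (if _ then _ else _); lia.
rewrite mul1r ltxx andbF add0r.
by have -> : U <= U + Posz N < U + Posz (N + 1) by lia.
Qed.

Section OneVariable.
Variables (T : eqType) (s : seq T) (q : T -> int) (f : T -> int) (n : nat).
Variable g : int -> int.
Hypothesis gE : forall z, g z = \sum_(t <- s) q t * geom n (z - f t).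

Lemma iter_fdiff_cells_eq0 V i : (forall t, t \in s -> f t < V) ->
  (n <= i)%N -> iter i (@fdiff int) g V = 0.
Proof.
move=> sV ni; rewrite (eq_iter_fdiff _ (fun z _ => gE z) (lexx V)).
rewrite iter_fdiff_sum big_seq big1 // => t ts.
by rewrite iter_fdiff_geom_eq0 ?mulr0 ?sV.
Qed.

(** Far enough to the right, at [V], all the Newton coefficients of the polynomial
    that agrees with [g] are nonnegative, because [g] is. The Newton expansion at
    [V] then decomposes the values above [V], and each of the finitely many values
    between [U] and [V] is a multiple of a monomial. *)
Lemma decomposable1_tail U : (forall z, U <= z -> 0 <= g z) ->
  decomposable1 n (fun z => if U <= z then g z else 0).
Proof.
move=> g0; pose p := \sum_(t <- s) (q t)%:~R *: hpoly n (f t).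
have evs : eventually (fun z => forall t, t \in s -> f t < z).
  by apply: eventually_all => t _; apply: eventually_gt.
have [W HW] := evs.
have gp z : W <= z -> (g z)%:~R = p.[z%:~R] :> rat.
  move=> /HW fz; rewrite gE horner_sum raddf_sum /= [LHS]big_seq [RHS]big_seq.
  by apply: eq_bigr => t /fz; rewrite hornerZ intrM => /horner_hpoly ->.
have gdp i z : W <= z ->
    (iter i (@fdiff int) g z)%:~R = (iter i dpoly p).[z%:~R].
  move=> Wz; rewrite -iter_fdiff_intr -iter_fdiff_horner.
  exact: (eq_iter_fdiff _ _ Wz).
have [|V0 HV0] := @eventually_lt n
    (fun i z => 0 <= (iter i dpoly p).[z%:~R]).
  move=> i _; apply: eventually_iter_dpoly.
  exists (Num.max W U) => z; rewrite ge_max => /andP[Wz Uz].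
  by rewrite -gp // ler0z g0.
pose V := Num.max U (Num.max W V0).
have [UV WV V0V] : [/\ U <= V, W <= V & V0 <= V].
  by rewrite /V !le_max !lexx !orbT.
pose l1 := [seq (g (U + Posz k), (0%N, U + Posz k)) | k <- iota 0 `|V - U|].
pose l2 := [seq (iter i (@fdiff int) g V, (i.+1, V + Posz i)) | i <- iota 0 n].
have [|l ln lE] := @nonneg_comb (nat * int) int (fun t z => geom t.1 (z - t.2))
    (fun t => (t.1 <= n)%N) (l1 ++ l2).
  rewrite all_cat; apply/andP; split; apply/allP => _ /mapP[k kl ->] /=.
    by rewrite g0 //; lia.
  move: kl; rewrite mem_iota => kn; rewrite andbC.
  by rewrite -(ler0z rat) gdp // HV0 // andbT.
exists l => // z; rewrite -lE big_cat /= !big_map /=.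
rewrite (eq_bigr (fun k => (z == U + Posz k)%:R * g (U + Posz k))); last first.
  by move=> k _; rewrite mulrC geom0 subr_eq0 natz.
rewrite sum_iota_delta.
have -> : U + Posz `|V - U| = V by lia.
have [Vz|zV] := leP V z; last first.
  rewrite andbT big1 ?addr0 // => i _; rewrite geom_neg ?mulr0 //; lia.
rewrite andbF add0r (le_trans UV Vz).
have [w ->] : exists w : nat, z = V + Posz w by exists `|z - V|%N; lia.
rewrite (@newton_trunc _ n) => [|i]; last exact: iter_fdiff_cells_eq0 (HW _ WV).
rewrite -[X in iota 0 X]subn0 -[iota _ _]/(index_iota 0 n) big_mkord.
apply: eq_bigr => i _; rewrite -mulr_natr natz -geomS.
by congr (_ * geom _ _); lia.
Qed.

End OneVariable.

(** * Positivity of the Newton coefficients *)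

Definition diffX (i k : nat) : {poly rat} := iter i dpoly 'X^k.

Lemma pdegXn k : pdeg k 'X^k.
Proof. by rewrite /pdeg size_polyXn leqnn coefXn eqxx ltr01. Qed.

(** The weak form of [pdeg], satisfied by the summands that do not contribute to the
    leading coefficient. *)
Definition wdeg (d : nat) (p : {poly rat}) : bool :=
  (size p <= d.+1)%N && (0 <= p`_d).

Lemma pdegW d p : pdeg d p -> wdeg d p.
Proof. by move=> /andP[sp /ltW pd]; rewrite /wdeg sp. Qed.

Lemma wdeg_lt d (p : {poly rat}) : (size p <= d)%N -> wdeg d p.
Proof. by move=> sp; rewrite /wdeg leqW // nth_default. Qed.

Lemma wdegD d p q : wdeg d p -> wdeg d q -> wdeg d (p + q).
Proof.
move=> /andP[sp pd] /andP[sq qd]; rewrite /wdeg coefD addr_ge0 // andbT.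
by rewrite (leq_trans (size_polyD _ _)) // geq_max sp.
Qed.

Lemma pdegD d p q : pdeg d p -> wdeg d q -> pdeg d (p + q).
Proof.
move=> /andP[sp pd] /andP[sq qd]; rewrite /pdeg coefD ltr_pwDl // andbT.
by rewrite (leq_trans (size_polyD _ _)) // geq_max sp.
Qed.

Lemma wdeg_sum d (T : eqType) (s : seq T) (F : T -> {poly rat}) :
  (forall t, t \in s -> wdeg d (F t)) -> wdeg d (\sum_(t <- s) F t).
Proof.
move=> sF; rewrite big_seq; elim/big_ind: _ => //; last exact: wdegD.
by apply: wdeg_lt; rewrite size_poly0.
Qed.

(** The iterated difference of P of orders [i] and [j] in the two variables,
    evaluated at the diagonal point (X, X). *)
Definition newton_poly (P : {mpoly rat[2]}) (i j : nat) : {poly rat} :=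
  \sum_(k <- msupp P) P@_k *: (diffX i (k ord0) * diffX j (k ord_max)).

(** A monomial z^k survives the differences when k >= (i, j), and then contributes
    in degree |k| - i - j with the sign of its coefficient. The surviving
    monomials of maximal total degree divide no other monomial of P: such a
    multiple would survive as well and have larger degree. Hence their
    coefficients are positive and they make up the leading coefficient. *)
Lemma newton_poly_eventually P i j : positive_extremal_coefs P ->
  eventually (fun z => 0 <= (newton_poly P i j).[z%:~R]).
Proof.
move=> Pext.
pose S := [seq k : 'X_{1..2} <- msupp P | (i <= k ord0)%N && (j <= k ord_max)%N].
have notS k : k \in msupp P -> k \notin S ->
    P@_k *: (diffX i (k ord0) * diffX j (k ord_max)) = 0.
  move=> kP; rewrite mem_filter kP andbT negb_and -!ltnNge.
  case/orP=> lt; rewrite /diffX (iter_dpoly_eq0 (pdegXn _) lt).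
    by rewrite mul0r scaler0.
  by rewrite mulr0 scaler0.
case: (S =P [::]) => [S0|/eqP]; last rewrite -has_filter => /hasP[k0 k0P k0S].
  exists 0 => z _; rewrite /newton_poly big_seq big1 ?horner0 // => k kP.
  by rewrite notS // S0.
have {k0S k0P}k0S : k0 \in S by rewrite mem_filter k0S.
have [k kS kmax] := seq_argmax (fun k : 'X_{1..2} => k ord0 + k ord_max)%N k0S.
suff /pdeg_eventually[U HU] :
    pdeg (k ord0 - i + (k ord_max - j)) (newton_poly P i j).
  by exists U => z /HU /ltW.
have termS l : l \in S -> (l ord0 + l ord_max = k ord0 + k ord_max)%N ->
    pdeg (k ord0 - i + (k ord_max - j))
      (P@_l *: (diffX i (l ord0) * diffX j (l ord_max))).
  move=> lS lk; move: (lS) (kS); rewrite !mem_filter.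
  move=> /andP[/andP[il jl] lP] /andP[/andP[ik jk] kP].
  have -> : (k ord0 - i + (k ord_max - j) = l ord0 - i + (l ord_max - j))%N.
    by lia.
  apply: pdegZ; last by apply: pdegM; apply: pdeg_iter_dpoly => //; apply: pdegXn.
  apply: Pext; split => // l' l'P l'l; apply/negP => /mnm_lepP ll'.
  have l0 := ll' ord0; have l1 := ll' ord_max.
  have l'S : l' \in S by rewrite mem_filter l'P andbT; lia.
  have l'k := kmax _ l'S; case/negP: l'l; apply/eqP.
  by rewrite [l']mnE [l]mnE; congr mn; lia.
move: (kS); rewrite mem_filter => /andP[/andP[ik jk] kP].
rewrite /newton_poly (big_rem _ kP) /=; apply: pdegD; first exact: termS.
apply: wdeg_sum => l /mem_rem lP.
have [lS|/(notS _ lP) ->] := boolP (l \in S); last first.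
  by apply: wdeg_lt; rewrite size_poly0.
have := kmax _ lS; rewrite leq_eqVlt => /orP[/eqP /(termS _ lS)/pdegW //|lk].
move: lS; rewrite mem_filter => /andP[/andP[il jl] _].
apply: wdeg_lt; apply: leq_trans (size_scale_leq _ _) _.
have /andP[s1 _] : pdeg (l ord0 - i + (l ord_max - j))
    (diffX i (l ord0) * diffX j (l ord_max)).
  by apply: pdegM; apply: pdeg_iter_dpoly => //; apply: pdegXn.
apply: leq_trans s1 _; lia.
Qed.

Definition newton_coef (H : int * int -> int) (i j : nat) (U : int) : int :=
  iter j (@fdiff int) (fun y => iter i (@fdiff int) (fun x => H (x, y)) U) U.

Lemma newton_coefE H (P : {mpoly rat[2]}) U :
  (forall a, le2 (U, U) a -> (H a)%:~R = P.@[point2 a]) ->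
  forall i j, (newton_coef H i j U)%:~R = (newton_poly P i j).[U%:~R].
Proof.
move=> HP i j.
have diffXE e k : iter e (@fdiff rat) (fun z => z%:~R ^+ k) U
    = (diffX e k).[U%:~R].
  rewrite /diffX -iter_fdiff_horner; apply: (eq_iter_fdiff _ _ (lexx U)) => z _.
  by rewrite hornerXn.
rewrite /newton_coef -iter_fdiff_intr.
rewrite (@eq_iter_fdiff _ _ _ (fun y => \sum_(k <- msupp P)
    (P@_k * (diffX i (k ord0)).[U%:~R]) * y%:~R ^+ k ord_max) U) //; last first.
  move=> y Uy; rewrite -iter_fdiff_intr.
  rewrite (@eq_iter_fdiff _ _ _ (fun x => \sum_(k <- msupp P)
      (P@_k * y%:~R ^+ k ord_max) * x%:~R ^+ k ord0) U) //; last first.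
    move=> x Ux; rewrite HP ?/le2 /= ?Ux // mevalE; apply: eq_bigr => k _.
    rewrite big_ord_recl big_ord1 /=.
    have -> : lift ord0 ord0 = ord_max :> 'I_2 by apply: val_inj.
    by rewrite mulrA mulrAC.
  rewrite iter_fdiff_sum; apply: eq_bigr => k _.
  by rewrite diffXE mulrAC.
rewrite iter_fdiff_sum horner_sum; apply: eq_bigr => k _.
by rewrite diffXE hornerZ hornerM mulrA.
Qed.

(** Newton's formula in each variable in turn. The expansion stops at orders [m]
    and [n] because (U, U) lies strictly beyond the corners of all the cells. *)
Lemma newton_quadrant (s : seq (int * int)) Q m n H U :
  (forall a, H a = \sum_(c <- s) Q c * cell ((m, n), c) a) ->
  (forall c, c \in s -> c.1 < U /\ c.2 < U) ->
  forall a, (if le2 (U, U) a then H a else 0) =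
    \sum_(i < m) \sum_(j < n) newton_coef H i j U *
      cell ((i.+1, j.+1), (U + Posz i, U + Posz j)) a.
Proof.
move=> HE sU a; case: ifPn => [|Ua]; last first.
  rewrite big1 // => i _; rewrite big1 // => j _; rewrite /cell /=.
  move: Ua; rewrite /le2 /= negb_and -!ltNge => /orP[lt|lt].
    by rewrite geom_neg ?mul0r ?mulr0 //; lia.
  by rewrite [X in _ * (_ * X)]geom_neg ?mulr0 //; lia.
case: a => x y /andP[/= Ux Uy].
have [v yE] : exists v : nat, y = U + Posz v by exists `|y - U|%N; lia.
have [w xE] : exists w : nat, x = U + Posz w by exists `|x - U|%N; lia.
have Hx z : forall x, H (x, z) =
    \sum_(c <- s) (Q c * geom n (z - c.2)) * geom m (x - c.1).
  by move=> x'; rewrite HE; apply: eq_bigr => c _; rewrite /cell /= mulrAC mulrA.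
have Hy i : forall z, iter i (@fdiff int) (fun x => H (x, z)) U = \sum_(c <- s)
    (Q c * iter i (@fdiff int) (fun x => geom m (x - c.1)) U) * geom n (z - c.2).
  move=> z; rewrite (eq_iter_fdiff _ (fun x _ => Hx z x) (lexx U)).
  by rewrite iter_fdiff_sum; apply: eq_bigr => c _; rewrite mulrAC.
rewrite {1}xE (@newton_trunc _ m (fun x => H (x, y))); last first.
  move=> i; apply: (iter_fdiff_cells_eq0 (Hx y)) => c /sU[]; exact.
apply: eq_bigr => i _.
rewrite {1}yE (@newton_trunc _ n
  (fun y => iter i (@fdiff int) (fun x => H (x, y)) U)); last first.
  move=> j; apply: (iter_fdiff_cells_eq0 (Hy i)) => c /sU[]; exact.
rewrite -sumrMnl; apply: eq_bigr => j _.
rewrite -mulrnA -[LHS]mulr_natr natz PoszM mulrC /cell /= -!geomS mulrC.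
rewrite [X in _ * X]mulrC; congr (_ * (geom _ _ * geom _ _)); lia.
Qed.

(** * From the conditions to cells *)

Lemma decomposable_ext m n H H' : H =1 H' -> decomposable m n H' ->
  decomposable m n H.
Proof. by move=> E [l lmn lE]; exists l => // a; rewrite E. Qed.

Lemma decomposableD m n H H' : decomposable m n H -> decomposable m n H' ->
  decomposable m n (fun a => H a + H' a).
Proof.
move=> [l lmn lE] [l' lmn' lE']; exists (l ++ l').
  by rewrite all_cat lmn.
by move=> a; rewrite big_cat lE lE'.
Qed.

Lemma decomposable_sum m n (T : eqType) (s : seq T) F :
  (forall t, t \in s -> decomposable m n (F t)) ->
  decomposable m n (fun a => \sum_(t <- s) F t a).
Proof.
elim: s => [|t s IH] sF.
  by exists [::] => // a; rewrite !big_nil.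
apply: (@decomposable_ext _ _ _ (fun a => F t a + \sum_(t <- s) F t a)).
  by move=> a; rewrite big_cons.
apply: decomposableD; first by apply: sF; rewrite mem_head.
by apply: IH => u us; apply: sF; rewrite inE us orbT.
Qed.

(** A column is a series in t2 alone times a power of t1: the cells have i = 0. *)
Lemma decomposable_col m n x g : decomposable1 n g ->
  decomposable m n (fun a => (a.1 == x)%:R * g a.2).
Proof.
move=> [l ln lE]; exists [seq ((0%N, t.1), (x, t.2)) | t <- l].
  by rewrite all_map; apply: sub_all ln => t /= ->.
move=> a; rewrite big_map lE mulr_sumr; apply: eq_bigr => t _.
by rewrite /cell /= geom0 subr_eq0 natz.
Qed.

Lemma decomposable_row m n y g : decomposable1 m g ->
  decomposable m n (fun a => (a.2 == y)%:R * g a.1).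
Proof.
move=> [l ln lE]; exists [seq ((t.1, 0%N), (t.2, y)) | t <- l].
  by rewrite all_map; apply: sub_all ln => t /= ->.
move=> a; rewrite big_map lE mulr_sumr; apply: eq_bigr => t _.
by rewrite /cell /= geom0 subr_eq0 natz mulrC.
Qed.

(** The plane is cut into the quadrant above (U, U), the columns to the left of it
    and the rows below it. The columns run over all heights, and the rows only over
    abscissas at least [U], so that the three parts do not overlap. *)
Theorem conditions_decomposable m n H : laurent_series H ->
  nonneg_series H -> laurent_polynomial (mul_series H (denom m n)) ->
  positive_extremal_coefs (hilbert_poly H) -> decomposable m n H.
Proof.
move=> lH H0 lQ Hext; have [s [Q HE]] := laurent_cells lH lQ.
have [b Hb] := lH.
have := is_hilbert_poly_cells (f := fun c => ((m, n), c)) HE.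
move=> /(@ex_intro _ _ _) /hilbert_polyP; set P := hilbert_poly H => -[u Hu].
have evs : eventually (fun z => forall c, c \in s -> c.1 < z /\ c.2 < z).
  by apply: eventually_all => c _; apply: eventually_and; apply: eventually_gt.
have evc : eventually (fun z => forall i, (i < m)%N -> forall j, (j < n)%N ->
    0 <= (newton_poly P i j).[z%:~R]).
  by apply: eventually_lt => i _; apply: eventually_lt => j _;
    apply: newton_poly_eventually.
have [U0 HU0] := eventually_and evs evc.
(* Beyond the corners of the cells, the range where H = P, and the support bound. *)
pose U := Num.max (Num.max U0 (Num.max b.1 b.2)) (Num.max u.1 u.2).
have [U0U b1U b2U] : [/\ U0 <= U, b.1 <= U & b.2 <= U].
  by rewrite /U !le_max !lexx !orbT.
have [u1U u2U] : u.1 <= U /\ u.2 <= U by rewrite /U !le_max !lexx !orbT.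
have [sU cU] := HU0 _ U0U.
have cU' i j : (i < m)%N -> (j < n)%N -> 0 <= newton_coef H i j U.
  move=> im jn; rewrite -(ler0z rat) (@newton_coefE _ P) ?cU //.
  move=> a /andP[/= Ua1 Ua2]; apply: Hu; rewrite /le2.
  by rewrite (le_trans u1U) // (le_trans u2U).
pose H1 a := \sum_(k <- iota 0 `|U - b.1|)
  (a.1 == b.1 + Posz k)%:R *
  (if b.2 <= a.2 then H (b.1 + Posz k, a.2) else 0).
pose H2 a := \sum_(k <- iota 0 `|U - b.2|)
  (a.2 == b.2 + Posz k)%:R * (if U <= a.1 then H (a.1, b.2 + Posz k) else 0).
pose H3 a := if le2 (U, U) a then H a else 0.
apply: (@decomposable_ext _ _ _ (fun a => H1 a + (H2 a + H3 a))).
  move=> [x y]; rewrite /H1 /H2 /H3 /le2 /=.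
  rewrite (sum_iota_delta (fun x => if b.2 <= y then H (x, y) else 0)).
  rewrite (sum_iota_delta (fun y => if U <= x then H (x, y) else 0)).
  have -> : b.1 + Posz `|U - b.1| = U by lia.
  have -> : b.2 + Posz `|U - b.2| = U by lia.
  have [b1x|xb1] := leP b.1 x; last first.
    have -> : (U <= x) = false by lia.
    by rewrite Hb /le2 /= ?(lt_geF xb1) //; case: ifP; rewrite !addr0.
  have [b2y|yb2] := leP b.2 y; last first.
    have -> : (U <= y) = false by lia.
    rewrite Hb /le2 /= ?(lt_geF yb2) ?andbF //.
    by rewrite !if_same !addr0.
  have [Ux|xU] := leP U x; last by rewrite /= if_same !addr0.
  by have [Uy|yU] := leP U y; rewrite /= ?add0r ?addr0.
apply: decomposableD; last apply: decomposableD.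
- apply: decomposable_sum => k _.
  apply: (@decomposable_col _ _ _ (fun y => if b.2 <= y then
    H (b.1 + Posz k, y) else 0)).
  apply: (@decomposable1_tail _ s (fun c => Q c * geom m (b.1 + Posz k - c.1))
    (fun c => c.2)) => // y.
  by rewrite HE; apply: eq_bigr => c _; rewrite mulrA.
- apply: decomposable_sum => k _.
  apply: (@decomposable_row _ _ _ (fun x => if U <= x then
    H (x, b.2 + Posz k) else 0)).
  apply: (@decomposable1_tail _ s (fun c => Q c * geom n (b.2 + Posz k - c.2))
    (fun c => c.1)) => // x.
  by rewrite HE; apply: eq_bigr => c _; rewrite /cell /= mulrAC mulrA.
- pose l := [seq (newton_coef H i j U, ((i.+1, j.+1), (U + Posz i, U + Posz j)))
    | i <- iota 0 m, j <- iota 0 n].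
  have [|l' lmn lE] := @nonneg_comb _ _ cell
      (fun t => (t.1.1 <= m)%N && (t.1.2 <= n)%N) l.
    apply/allP => _ /allpairsP[[i j] [/= im jn ->]] /=.
    by move: im jn; rewrite !mem_iota /= => im jn; rewrite cU' ?im.
  exists l' => // a; rewrite -lE [H3 a](newton_quadrant HE sU).
  rewrite big_allpairs_dep /=.
  rewrite -[X in iota 0 X]subn0 -[iota _ _]/(index_iota 0 m) big_mkord.
  apply: eq_bigr => i _.
  by rewrite -[X in iota 0 X]subn0 -[iota _ _]/(index_iota 0 n) big_mkord.
Qed.

(** * Exponent vectors *)

Definition unitd (t : bool) : int * int := if t then (1, 0) else (0, 1).

(** Exponent vectors are lists, so that one can recurse on the variables one by one;
    the list [ty] tells for each variable whether its degree is (1, 0) or (0, 1). *)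
Fixpoint xdeg (ty : seq bool) (x : seq nat) : int * int :=
  match ty, x with
  | t :: ty', k :: x' => unitd t *+ k + xdeg ty' x'
  | _, _ => 0
  end.

(** The bound on the first exponent is generous: larger first exponents leave a
    negative bidegree to the others and produce nothing. *)
Fixpoint expo (ty : seq bool) (a : int * int) : seq (seq nat) :=
  match ty with
  | [::] => if a == 0 then [:: [::]] else [::]
  | t :: ty' => flatten [seq map (cons k) (expo ty' (a - unitd t *+ k))
                        | k <- iota 0 (`|a.1| + `|a.2|).+1]
  end.

Lemma expo_cons t ty a : expo (t :: ty) a =
  flatten [seq map (cons k) (expo ty (a - unitd t *+ k))
          | k <- iota 0 (`|a.1| + `|a.2|).+1].
Proof. by []. Qed.

Lemma unitdMn t k :
  unitd t *+ k = if t then (Posz k, 0) else (0, Posz k).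
Proof.
elim: k => [|k IH]; first by case: t.
by rewrite mulrS IH; case: t {IH}; rewrite /unitd; congr (_, _) => /=; lia.
Qed.

Lemma xdeg_ge0 ty x : 0 <= (xdeg ty x).1 /\ 0 <= (xdeg ty x).2.
Proof.
elim: ty x => [|t ty IH] [|k x] //=.
by have [h1 h2] := IH x; rewrite unitdMn; case: t => /=; lia.
Qed.

Lemma mem_expo ty a x :
  (x \in expo ty a) = (size x == size ty) && (xdeg ty x == a).
Proof.
elim: ty a x => [|t ty IH] a x.
  rewrite /= [0 == a]eq_sym; case: (a == 0); last by rewrite andbF.
  by rewrite inE andbT size_eq0.
apply/flatten_mapP/idP => [[k _ /mapP[y]]|].
  rewrite IH => /andP[/eqP sy /eqP dy] -> /=.
  by rewrite sy dy eqxx addrC subrK eqxx.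
case: x => [//|k x] /andP[sx /eqP]; rewrite [xdeg _ _]/= => <-; exists k.
  rewrite mem_iota unitdMn; have := xdeg_ge0 ty x.
  by case: t {sx} => /=; lia.
by apply: map_f; rewrite IH -eqSS sx /= addrC addKr.
Qed.

Lemma uniq_expo ty a : uniq (expo ty a).
Proof.
elim: ty a => [|t ty IH] a; first by rewrite /=; case: ifP.
rewrite expo_cons; move: (iota _ _) (iota_uniq 0 (`|a.1| + `|a.2|).+1) => s.
elim: s => //= k s IHs /andP[ks us]; rewrite cat_uniq IHs // andbT.
rewrite map_inj_uniq ?IH //=; last by move=> x y [].
apply/hasPn => x /flatten_mapP[k' k's /mapP[y _ ->]].
apply/negP => /mapP[z _ [kk' _]]; by rewrite -kk' k's in ks.
Qed.

(** * Boxes *)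

Definition inside (fc : bool * nat) (k : nat) : bool :=
  if fc.1 then (fc.2 <= k)%N else k == fc.2.

Fixpoint inbox (b : seq (bool * nat)) (x : seq nat) : bool :=
  match b, x with
  | fc :: b', k :: x' => inside fc k && inbox b' x'
  | [::], [::] => true
  | _, _ => false
  end.

Definition free_dirs (t : bool) (ty : seq bool) (b : seq (bool * nat)) : nat :=
  count (fun p => (p.1 == t) && p.2.1) (zip ty b).

Lemma sum_geom_free p z (c N : nat) : z < Posz N ->
  \sum_(k <- iota 0 N) (c <= k)%N%:R * geom p (z - Posz k) = geom p.+1 (z - Posz c).
Proof.
move=> zN.
have E M : \sum_(k <- iota 0 M) (c <= k)%N%:R * geom p (z - Posz k) =
    if (c <= M)%N then geom p.+1 (z - Posz c) - geom p.+1 (z - Posz M) else 0.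
  elim: M => [|M IH]; first by rewrite big_nil; case: c => //=; rewrite subrr.
  rewrite -[in iota _ _]addn1 iotaD big_cat big_seq1 IH add0n /=.
  have [cM|Mc] := leqP c M.
    rewrite leqW // mul1r -[geom p _]geomB (_ : z - Posz M - 1 = z - Posz M.+1); last lia.
    by rewrite addrA subrK.
  rewrite mul0r addr0; case: leqP => // cM.
  by rewrite (_ : c = M.+1) ?subrr //; lia.
rewrite E [geom _ (z - Posz N)]geom_neg ?subr0; last lia.
by case: leqP => // Nc; rewrite geom_neg //; lia.
Qed.

Lemma sum_geom_fixed p z (c N : nat) : z < Posz N ->
  \sum_(k <- iota 0 N) (k == c)%:R * geom p (z - Posz k) = geom p (z - Posz c).
Proof.
move=> zN; have [cN|Nc] := ltnP c N; last first.
  rewrite geom_neg; last lia.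
  rewrite big_seq big1 // => k; rewrite mem_iota => kN.
  by have -> : (k == c) = false by [lia]; rewrite mul0r.
rewrite (bigD1_seq c) ?iota_uniq ?mem_iota //= eqxx mul1r big1 ?addr0 //.
by move=> k /negbTE ->; rewrite mul0r.
Qed.

Lemma sum_geom_inside p z fc (N : nat) : z < Posz N ->
  \sum_(k <- iota 0 N) (inside fc k)%:R * geom p (z - Posz k) =
  geom (fc.1 + p) (z - Posz fc.2).
Proof.
by case: fc => [[] c] zN; [apply: sum_geom_free | apply: sum_geom_fixed].
Qed.

(** Peel off the first variable: a fixed exponent shifts the series, and an exponent
    bounded below multiplies it by a shifted geometric series. *)
Lemma count_box ty b a : size b = size ty ->
  Posz (count (inbox b) (expo ty a)) =
  cell ((free_dirs true ty b, free_dirs false ty b), xdeg ty (map snd b)) a.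
Proof.
elim: ty b a => [|t ty IH] [|fc b] a //.
  move=> _ /=; rewrite /cell /= !subr0 !geom0; case: a => x y.
  by rewrite -pair_eqE /=; do 2!case: (_ == 0).
move=> [sb]; rewrite expo_cons.
have [N aN NE] : exists2 N, (`|a.1| + `|a.2| < N)%N &
  N = (`|a.1| + `|a.2|).+1 by eexists; [exact: ltnSn|].
rewrite -NE [xdeg _ _]/=.
have -> : Posz (count (inbox (fc :: b)) (flatten
    [seq map (cons k) (expo ty (a - unitd t *+ k))
    | k <- iota 0 N])) =
  \sum_(k <- iota 0 N) (inside fc k)%:R *
    cell ((free_dirs true ty b, free_dirs false ty b), xdeg ty (map snd b))
      (a - unitd t *+ k).
  elim: (iota _ _) => [|k s IHs]; first by rewrite big_nil.
  rewrite /= big_cons count_cat PoszD IHs; congr (_ + _).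
  rewrite count_map -IH //; case E : (inside fc k).
    by rewrite mul1r; congr Posz; apply: eq_count => x /=; rewrite E.
  rewrite mul0r (@eq_count _ _ pred0) ?count_pred0 // => x.
  by rewrite /= E.
have [d1 d2] := xdeg_ge0 ty (map snd b).
move: (xdeg ty _) d1 d2 => d d1 d2; rewrite /cell /free_dirs /=.
case: t.
  rewrite (eq_bigr (fun k => (inside fc k)%:R *
      geom (free_dirs true ty b) (a.1 - d.1 - Posz k) *
      geom (free_dirs false ty b) (a.2 - d.2))); last first.
    move=> k _; rewrite unitdMn /= subr0 mulrA; congr (_ * geom _ _ * _).
    by rewrite addrAC.
  rewrite -mulr_suml sum_geom_inside; last lia.
  by rewrite unitdMn /= !add0n add0r; congr (geom _ _ * _); lia.
rewrite (eq_bigr (fun k => geom (free_dirs true ty b) (a.1 - d.1) *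
    ((inside fc k)%:R * geom (free_dirs false ty b) (a.2 - d.2 - Posz k)))); last first.
  move=> k _; rewrite unitdMn /= subr0 mulrCA; congr (_ * (_ * geom _ _)).
  by rewrite addrAC.
rewrite -mulr_sumr sum_geom_inside; last lia.
by rewrite unitdMn /= !add0n add0r; congr (_ * geom _ _); lia.
Qed.

(** * Down-sets are finite disjoint unions of boxes *)

Definition downset (n : nat) (D : seq nat -> bool) : Prop :=
  forall x y, size x = n -> size y = n -> all2 leq x y -> D y -> D x.

Lemma all2_leqnn x : all2 leq x x.
Proof. by elim: x => //= k x ->; rewrite leqnn. Qed.

Lemma downset_cons n D k : downset n.+1 D -> downset n (fun x => D (k :: x)).
Proof.
by move=> dD x y sx sy xy; apply: dD; rewrite /= ?sx ?sy ?leqnn.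
Qed.

(** Induction on [n], with the first coordinate as an extra index. The diagonal
    slices, at level [k] and first coordinate [k], form a chain, stable from some
    k1 on; monotonicity in both indices then freezes every slice with first
    coordinate and level at least k1. For each of the finitely many smaller first
    coordinates the slices form a chain of their own. *)
Lemma downset_chain_stable n (D : nat -> seq nat -> bool) :
  (forall k, downset n (D k)) ->
  (forall k x, size x = n -> D k.+1 x -> D k x) ->
  exists k0, forall k x, (k0 <= k)%N -> size x = n -> D k x = D k0 x.
Proof.
elim: n D => [|n IH] D dD cD.
  have [[k0 Dk0]|all_D] := classic (exists k0, ~~ D k0 [::]).
    exists k0 => k x kk /size0nil ->; apply/idP/idP => [|/(negP Dk0) //].
    rewrite -(subnK kk); elim: (k - k0)%N => // i Hi Di; exact/Hi/cD.
  exists 0%N => k x _ /size0nil ->.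
  have allT i : D i [::] by apply/negPn/negP => Di; apply: all_D; exists i.
  by rewrite !allT.
have mono i k x : size x = n.+1 -> (i <= k)%N -> D k x -> D i x.
  move=> sx ik; rewrite -(subnK ik); elim: (k - i)%N => // j Hj Dj.
  exact/Hj/cD.
have [||k1 Hk1] := IH (fun k x => D k (k :: x)).
- by move=> k; apply: downset_cons.
- move=> k x sx Dk; apply: (mono k k.+1) => //=; first by rewrite sx.
  by apply: dD Dk; rewrite /= ?sx ?leqnSn ?all2_leqnn.
have [k2 Hk2] : exists k2, forall l k x, (l < k1)%N -> (k2 <= k)%N ->
    size x = n -> D k (l :: x) = D k2 (l :: x).
  elim: {Hk1}k1 => [|k1 [k2 Hk2]]; first by exists 0%N.
  have [||k3 Hk3] := IH (fun k x => D k (k1 :: x)).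
  - by move=> k; apply: downset_cons.
  - by move=> k x sx; apply: cD; rewrite /= sx.
  exists (maxn k2 k3) => l k x; rewrite ltnS leq_eqVlt geq_max.
  case/orP=> [/eqP ->|lk1] /andP[k2k k3k] sx.
    by rewrite Hk3 // [RHS]Hk3 // leq_maxr.
  by rewrite Hk2 // [RHS]Hk2 // leq_maxl.
have large l k x : (k1 <= l)%N -> (k1 <= k)%N -> size x = n ->
    D k (l :: x) = D k1 (k1 :: x).
  move=> k1l k1k sx; apply/idP/idP => [Dk|].
    apply: (mono k1 k) => //=; first by rewrite sx.
    by apply: dD Dk; rewrite /= ?sx ?k1l ?all2_leqnn.
  rewrite -(Hk1 (maxn k l)) ?leq_max ?k1k // => Dm.
  apply: (mono k (maxn k l)); rewrite /= ?sx ?leq_maxl //.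
  by apply: dD Dm; rewrite /= ?sx ?leq_maxr ?all2_leqnn.
exists (maxn k1 k2) => k [//|l x]; rewrite geq_max => /andP[k1k k2k] [sx].
have [lk1|k1l] := ltnP l k1.
  by rewrite Hk2 // [RHS]Hk2 // leq_maxr.
by rewrite !large // leq_maxl.
Qed.

(** The slices of [D] at first coordinate [k] decrease with [k], hence are constant
    from some k0 on: that part gives boxes unbounded in the first coordinate, and
    the finitely many earlier slices give boxes where it is fixed. The sum on the
    right expresses that the boxes are disjoint. *)
Lemma downset_boxes n D : downset n D ->
  exists2 bs : seq (seq (bool * nat)), all (fun b => size b == n) bs
    & forall x, size x = n -> nat_of_bool (D x) = (\sum_(b <- bs) inbox b x)%N.
Proof.
elim: n D => [|n IH] D dD.
  exists (if D [::] then [:: [::]] else [::]); first by case: ifP.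
  by move=> x /size0nil ->; case: ifP; rewrite ?big_seq1 ?big_nil.
have [||k0 Hk0] := @downset_chain_stable n (fun k x => D (k :: x)).
- by move=> k; apply: downset_cons.
- move=> k x sx; apply: dD; rewrite /= ?sx ?leqnSn ?all2_leqnn //.
have [bs sbs bsE] := IH _ (downset_cons (k := k0) dD).
have [cs scs csE] : exists2 cs : seq (seq (bool * nat)),
    all (fun b => size b == n.+1) cs &
    forall k x, size x = n ->
      (if (k < k0)%N then nat_of_bool (D (k :: x)) else 0%N) =
      (\sum_(b <- cs) inbox b (k :: x))%N.
  elim: {Hk0 bs sbs bsE}k0 => [|k0 [cs scs csE]].
    by exists [::] => // k x _; rewrite big_nil.
  have [bs sbs bsE] := IH _ (downset_cons (k := k0) dD).
  exists (map (cons (false, k0)) bs ++ cs).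
    by rewrite all_cat scs andbT all_map.
  move=> k x sx; rewrite big_cat -csE // big_map /= /inside /= ltnS leq_eqVlt.
  case: eqP => [->|_] /=; last by rewrite big1.
  by rewrite ltnn addn0 -bsE.
exists (map (cons (true, k0)) bs ++ cs).
  by rewrite all_cat scs andbT all_map.
case=> [//|k x] [sx]; rewrite big_cat -csE // big_map /= /inside /=.
case: leqP => [k0k|kk0] /=; last by rewrite big1.
by rewrite addn0 -bsE // Hk0.
Qed.

Lemma free_dirs_leq t ty b : (free_dirs t ty b <= count_mem t ty)%N.
Proof.
elim: ty b => [|u ty IH] [|fc b] //=; rewrite /free_dirs /=; apply: leq_add.
  by case: (u == t) => //=; apply: leq_b1.
exact: IH.
Qed.

Lemma downset_cells ty D : downset (size ty) D ->
  exists2 l : seq ((nat * nat) * (int * int)),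
    all (fun t => (t.1.1 <= count_mem true ty)%N &&
                  (t.1.2 <= count_mem false ty)%N) l
    & forall a, Posz (count D (expo ty a)) = \sum_(t <- l) cell t a.
Proof.
move=> /downset_boxes[bs sbs bsE].
exists [seq ((free_dirs true ty b, free_dirs false ty b),
  xdeg ty (map snd b)) | b <- bs].
  by apply/allP => _ /mapP[b _ ->] /=; rewrite !free_dirs_leq.
move=> a; rewrite big_map.
transitivity (\sum_(b <- bs) Posz (count (inbox b) (expo ty a))); last first.
  rewrite [LHS]big_seq [RHS]big_seq; apply: eq_bigr => b bbs.
  by apply: count_box; apply/eqP; apply: (allP sbs).
rewrite -(big_morph Posz PoszD (erefl _)); congr Posz.
rewrite -sum1_count big_mkcond big_seq.
transitivity (\sum_(x <- expo ty a) \sum_(b <- bs) inbox b x)%N.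
  rewrite [RHS]big_seq; apply: eq_bigr => x.
  by rewrite mem_expo => /andP[/eqP /bsE <- _]; case: (D x).
rewrite exchange_big; apply: eq_bigr => b _.
by rewrite -sum1_count [RHS]big_mkcond; apply: eq_bigr => x _; case: inbox.
Qed.

Definition asbool (P : Prop) : bool :=
  if excluded_middle_informative P then true else false.

Lemma asboolP P : reflect P (asbool P).
Proof. by rewrite /asbool; case: excluded_middle_informative => ?; constructor. Qed.

(** * Exponent vectors as multinomials *)

Section Multinomials.
Variables m mt : nat.

Definition vars : seq bool := nseq m true ++ nseq mt false.

Lemma size_vars : size vars = (m + mt)%N.
Proof. by rewrite size_cat !size_nseq. Qed.

Definition mon (x : seq nat) : 'X_{1..(m + mt)%N} :=
  [multinom nth 0%N x i | i < (m + mt)%N].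

Lemma bidegD (k l : 'X_{1..(m + mt)%N}) : bideg (k + l)%MM = bideg k + bideg l.
Proof.
rewrite /bideg; congr (_, _) => /=; rewrite -PoszD; congr Posz;
  by rewrite -big_split; apply: eq_bigr => i _; rewrite mnmDE.
Qed.

Lemma bideg_mon x : size x = (m + mt)%N -> bideg (mon x) = xdeg vars x.
Proof.
move=> sx; rewrite /bideg.
rewrite (eq_bigr (fun i : 'I_m => nth 0%N x i)); last by move=> i _; rewrite mnmE.
rewrite [X in (_, Posz X)](eq_bigr (fun j : 'I_mt => nth 0%N x (m + j))); last first.
  by move=> i _; rewrite mnmE.
rewrite /vars; elim: m x sx => [|m' IH] x sx; last first.
  case: x sx => // k x [sx].
  rewrite [xdeg _ _](_ : _ = unitd true *+ k + xdeg (nseq m' true ++ nseq mt false) x) //.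
  rewrite -IH // unitdMn big_ord_recl /=.
  by congr (_, _); rewrite ?PoszD //= add0r.
rewrite big_ord0 /=; elim: mt x sx => [|mt' IH] x sx; first by rewrite big_ord0.
case: x sx => // k x [sx].
rewrite [xdeg _ _](_ : _ = unitd false *+ k + xdeg (nseq mt' false) x) //.
rewrite -IH // unitdMn big_ord_recl /=.
by congr (_, _).
Qed.

Lemma mon_val (k : 'X_{1..(m + mt)%N}) : mon (val k) = k.
Proof. by apply/mnmP => i; rewrite mnmE -mnm_nth. Qed.

Lemma mon_inj x y : size x = (m + mt)%N -> size y = (m + mt)%N ->
  mon x = mon y -> x = y.
Proof.
move=> sx sy /mnmP xy; apply: (@eq_from_nth _ 0%N); rewrite ?sx // => i ilt.
by have := xy (Ordinal ilt); rewrite !mnmE.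
Qed.

Lemma mon_leq x y : all2 leq x y -> size x = (m + mt)%N -> (mon x <= mon y)%MM.
Proof.
move=> xy sx; apply/mnm_lepP => i; rewrite !mnmE.
elim: x y {sx}(nat_of_ord i) xy => [|k x IH] [|l y] //= e.
by case/andP=> kl xy; case: e => [//|e]; apply: IH.
Qed.

End Multinomials.

(** * Linear algebra over the base field *)

Section Spans.
Variables (K : fieldType) (m mt : nat) (M : lmodType {mpoly K[(m + mt)%N]}).
Implicit Types (A B V : M -> Prop).

(** Spans over [K] and not over the polynomial ring: scalars are constant
    polynomials. *)
Inductive kspan A : M -> Prop :=
| kspan0 : kspan A 0
| kspan_cons c a x : A a -> kspan A x -> kspan A (c%:MP *: a + x).

Lemma kspanD A x y : kspan A x -> kspan A y -> kspan A (x + y).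
Proof.
move=> Ax Ay; elim: Ax => [|c a {}x Aa _ IH]; first by rewrite add0r.
by rewrite -addrA; apply: kspan_cons.
Qed.

Lemma kspanZ A c x : kspan A x -> kspan A (c%:MP *: x).
Proof.
elim=> [|d a {}x Aa _ IH]; first by rewrite scaler0; apply: kspan0.
by rewrite scalerDr scalerA -mpolyCM; apply: kspan_cons.
Qed.

Lemma kspan_mem A x : A x -> kspan A x.
Proof.
by move=> Ax; rewrite -[x]scale1r -mpolyC1 -[_ *: _]addr0; apply/kspan_cons/kspan0.
Qed.

Lemma kspan_trans A B x : (forall a, A a -> kspan B a) -> kspan A x -> kspan B x.
Proof.
move=> AB; elim=> [|c a {}x /AB Ba _ Bx]; first exact: kspan0.
by apply: kspanD => //; apply: kspanZ.
Qed.

Lemma kspan_sub A B x : (forall a, A a -> B a) -> kspan A x -> kspan B x.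
Proof. by move=> AB; apply: kspan_trans => a /AB; apply: kspan_mem. Qed.

Lemma kspan_mul A B p x : (forall a, A a -> B (p *: a)) ->
  kspan A x -> kspan B (p *: x).
Proof.
move=> AB; elim=> [|c a {}x /AB Ba _ Bx]; first by rewrite scaler0; apply: kspan0.
by rewrite scalerDr scalerA mulrC -scalerA; apply: kspan_cons.
Qed.

Lemma kspan_sum A (T : Type) (s : seq T) (F : T -> M) :
  (forall t, kspan A (F t)) -> kspan A (\sum_(t <- s) F t).
Proof. by move=> AF; elim/big_ind: _ => //; [apply: kspan0|apply: kspanD]. Qed.

Lemma has_dim_ext V V' d : (forall x, V x <-> V' x) -> has_dim V d -> has_dim V' d.
Proof.
move=> VV' [e [eV eI eS]]; exists e; split=> // [i|x /VV' /eS //].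
by apply/VV'.
Qed.

Lemma has_dim_kspan0 A : (forall a, ~ A a) -> has_dim (kspan A) 0.
Proof.
move=> A0; exists (fun=> 0); split=> [[]//|c _ []//|x].
case=> [|c a y /A0 //]; exists (fun=> 0); by rewrite big_ord0.
Qed.

Lemma has_dim_kspanS A a d : has_dim (kspan A) d -> ~ kspan A a ->
  has_dim (kspan (fun x => A x \/ x = a)) d.+1.
Proof.
move=> [e [eV eI eS]] Aa.
pose e' (i : 'I_d.+1) := oapp e a (unlift ord0 i).
have sumE (c : 'I_d.+1 -> K) : \sum_(i < d.+1) (c i)%:MP *: e' i =
    (c ord0)%:MP *: a + \sum_(i < d) (c (lift ord0 i))%:MP *: e i.
  rewrite big_ord_recl /e' unlift_none; congr (_ + _).
  by apply: eq_bigr => i _; rewrite liftK.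
exists e'; split=> [i|c|x].
- rewrite /e'; case: unliftP => [j _|_] /=; last by apply: kspan_mem; right.
  by apply: kspan_sub (eV j) => y; left.
- rewrite sumE => ce.
  have ca0 : c ord0 = 0.
    apply/eqP; apply/negPn/negP => nc0; apply: Aa.
    have -> : a = (- (c ord0)^-1)%:MP *:
        \sum_(i < d) (c (lift ord0 i))%:MP *: e i.
      rewrite -(addKr ((c ord0)%:MP *: a) (\sum_(i < d) _)) ce addr0.
      rewrite scalerN scalerA -mpolyCM mulNr mulVf // mpolyCN mpolyC1.
      by rewrite scaleN1r opprK.
    by apply/kspanZ/kspan_sum => i; apply: kspanZ.
  move: ce; rewrite ca0 mpolyC0 scale0r add0r => /eI c0 i.
  by case: (unliftP ord0 i) => [j|] ->.
- elim=> [|c b y [Ab|->] _ [c' ->]].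
  + by exists (fun=> 0); rewrite big1 // => i _; rewrite mpolyC0 scale0r.
  + have [c2 ->] := eS _ (kspan_mem Ab).
    exists (fun i => c' i + oapp (fun j => c * c2 j) 0 (unlift ord0 i)).
    rewrite !sumE unlift_none addr0 addrCA; congr (_ + _).
    rewrite scaler_sumr -big_split /=; apply: eq_bigr => i _.
    by rewrite liftK /= mpolyCD mpolyCM scalerDl scalerA addrC.
  + exists (fun i => c' i + (if unlift ord0 i is Some _ then 0 else c)).
    rewrite !sumE unlift_none mpolyCD scalerDl addrCA addrA; congr (_ + _).
    by apply: eq_bigr => i _; rewrite liftK addr0.
Qed.

(** Expressing either family through the other gives matrices [A], [B] with
    A B = 1. *)
Lemma has_dim_leq V d d' : has_dim V d -> has_dim V d' -> (d <= d')%N.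
Proof.
move=> [e [eV eI eS]] [e' [eV' eI' eS']].
have [A eA] := fin_all_exists (fun i => eS' _ (eV i)).
have [B eB] := fin_all_exists (fun i => eS _ (eV' i)).
apply: (@mulmx1_min K _ _ (\matrix_(i, j) A i j) (\matrix_(i, j) B i j)).
apply/matrixP => i k; rewrite !mxE; apply/eqP; rewrite -subr_eq0; apply/eqP.
move: k; apply: eI; under eq_bigr do rewrite mpolyCB scalerBl.
rewrite sumrB [X in _ - X](bigD1 i) //= eqxx mpolyC1 scale1r.
rewrite [X in _ - (_ + X)]big1 ?addr0; last first.
  by move=> k; rewrite eq_sym => /negbTE ->; rewrite mpolyC0 scale0r.
apply/eqP; rewrite subr_eq0; apply/eqP; rewrite [RHS]eA.
under [RHS]eq_bigr do rewrite eB scaler_sumr.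
rewrite exchange_big; apply: eq_bigr => k _ /=.
rewrite rmorph_sum scaler_suml; apply: eq_bigr => j _.
by rewrite /= !mxE mpolyCM scalerA.
Qed.

Lemma has_dim_uniq V d d' : has_dim V d -> has_dim V d' -> d = d'.
Proof. by move=> h h'; apply/eqP; rewrite eqn_leq !(@has_dim_leq V). Qed.

(** Append the vectors in increasing order: one that is not a combination of the
    earlier ones raises the dimension of the span by one, any other leaves the
    span unchanged. *)
Lemma has_dim_greedy (T : eqType) (lt : rel T) (v : T -> M) (P : pred T) s :
  (forall u w, lt u w -> ~~ lt w u) -> pairwise lt s ->
  (forall w, w \in s ->
     P w <-> ~ kspan (fun a => exists u, [/\ u \in s, lt u w & a = v u]) (v w)) ->
  has_dim (kspan (fun a => exists2 y, y \in s & a = v y)) (count P s).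
Proof.
move=> asym; have irr w : lt w w = false.
  by apply/negP => ww; have := asym _ _ ww; rewrite ww.
elim/last_ind: s => [|s w IH].
  by move=> _ _; apply: has_dim_kspan0 => a [].
rewrite pairwise_rcons => /andP[/allP sw ps] HP.
have {IH}/IH : forall u, u \in s -> P u <->
    ~ kspan (fun a => exists y, [/\ y \in s, lt y u & a = v y]) (v u).
  move=> u us; rewrite HP ?mem_rcons ?inE ?us ?orbT //.
  suff E : kspan (fun a => exists y, [/\ y \in rcons s w, lt y u & a = v y]) (v u)
    <-> kspan (fun a => exists y, [/\ y \in s, lt y u & a = v y]) (v u) by rewrite E.
  split; apply: kspan_sub => a [y [ys yu ->]]; exists y; split => //.
    move: ys; rewrite mem_rcons inE => /orP[/eqP yw|//].
    by have := asym _ _ (sw _ us); rewrite -yw yu.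
  by rewrite mem_rcons inE ys orbT.
move=> /(_ ps) IH; rewrite -cats1 count_cat /= addn0.
have Pw : P w <-> ~ kspan (fun a => exists2 y, y \in s & a = v y) (v w).
  rewrite HP ?mem_rcons ?mem_head //.
  suff E : kspan (fun a => exists y, [/\ y \in rcons s w, lt y w & a = v y]) (v w)
    <-> kspan (fun a => exists2 y, y \in s & a = v y) (v w) by rewrite E.
  split; apply: kspan_sub => a [y].
    move=> [ys yw ->]; exists y => //; move: ys yw.
    by rewrite mem_rcons inE => /orP[/eqP ->|//]; rewrite irr.
  by move=> ys ->; exists y; split; rewrite ?sw // mem_rcons inE ys orbT.
case: (boolP (P w)) => [/Pw nw|/negP nPw].
  rewrite addn1; apply: has_dim_ext (has_dim_kspanS IH nw) => x.
  split; apply: kspan_sub => a.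
    case=> [[y ys ->]|->]; last by exists w; rewrite // mem_cat mem_head orbT.
    by exists y; rewrite // mem_cat ys.
  move=> [y + ->]; rewrite mem_cat inE => /orP[ys|/eqP ->]; [left|by right].
  by exists y.
have {nPw Pw}Pw : kspan (fun a => exists2 y, y \in s & a = v y) (v w).
  by apply: NNPP => /Pw.
rewrite addn0; apply: has_dim_ext IH => x; split.
  by apply: kspan_sub => a [y ys ->]; exists y; rewrite // mem_cat ys.
apply: kspan_trans => a [y + ->]; rewrite mem_cat inE => /orP[ys|/eqP -> //].
by apply: kspan_mem; exists y.
Qed.

End Spans.

(** * From graded modules to cells *)

(** Grouping by degree, needed because the sum of the components is direct along
    duplicate-free lists of degrees. *)
Lemma big_collect (V : zmodType) (L : seq ((int * int) * V)) :
  \sum_(p <- L) p.2 = \sum_(a <- undup (map fst L)) \sum_(p <- L | p.1 == a) p.2.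
Proof.
under [RHS]eq_bigr do rewrite big_mkcond.
rewrite exchange_big [LHS]big_seq [RHS]big_seq; apply: eq_bigr => p pL /=.
rewrite (bigD1_seq p.1) ?undup_uniq ?mem_undup ?map_f //= eqxx.
by rewrite big1 ?addr0 // => b; rewrite eq_sym => /negbTE ->.
Qed.

Section GradedToCells.
Variables (K : fieldType) (m mt : nat) (M : lmodType {mpoly K[(m + mt)%N]}).
Variable G : int * int -> M -> Prop.
Hypothesis gG : is_grading G.

Lemma gradingN a x : G a x -> G a (- x).
Proof. by rewrite -sub0r; apply: (gradingB gG); apply: (grading0 gG). Qed.

Lemma gradingD a x y : G a x -> G a y -> G a (x + y).
Proof.
move=> ax ay; rewrite -[y]opprK; apply: (gradingB gG) => //.
exact: gradingN.
Qed.

Lemma grading_big a (T : eqType) (s : seq T) (P : pred T) (F : T -> M) :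
  (forall t, t \in s -> P t -> G a (F t)) -> G a (\sum_(t <- s | P t) F t).
Proof.
move=> sF; rewrite big_seq_cond; elim/big_ind: _ => [||t /andP[/sF] //].
  exact: (grading0 gG).
exact: gradingD.
Qed.

Lemma gradingX a k x : G a x -> G (bideg k + a) ('X_[k] *: x).
Proof.
by apply: (gradingZ gG) => l; rewrite msuppX inE => /eqP ->.
Qed.

Lemma gradingC a c x : G a x -> G a (c%:MP *: x).
Proof.
rewrite -{2}[a]add0r; apply: (gradingZ gG) => k.
rewrite msuppC; case: eqP => // _; rewrite inE => /eqP ->.
by rewrite /bideg !big1 // => i _; rewrite mnm0E.
Qed.

Lemma kspan_graded A a x : (forall u, A u -> G a u) -> kspan A x -> G a x.
Proof.
move=> AG; elim=> [|c u {}x /AG Gu _ Gx]; first exact: (grading0 gG).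
by apply: gradingD => //; apply: gradingC.
Qed.

Lemma grading_list (L : seq ((int * int) * M)) :
  (forall p, p \in L -> G p.1 p.2) -> \sum_(p <- L) p.2 = 0 ->
  forall a, \sum_(p <- L | p.1 == a) p.2 = 0.
Proof.
move=> LG L0 a; have [aL|aL] := boolP (a \in map fst L); last first.
  rewrite big_seq_cond big1 // => p /andP[pL /eqP pa].
  by case/negP: aL; rewrite -pa; apply: map_f.
apply: (grading_direct gG (s := undup (map fst L))
  (f := fun a => \sum_(p <- L | p.1 == a) p.2)); rewrite ?undup_uniq ?mem_undup //.
  by move=> b; apply: grading_big => p /LG + /eqP <-.
by rewrite -big_collect.
Qed.

(** Take all the homogeneous components of the given generators. *)
Lemma homogeneous_generators : finitely_generated M ->
  exists2 gs : seq ((int * int) * M), (forall g, g \in gs -> G g.1 g.2) &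
    forall x, kspan (fun u => exists2 g, g \in gs &
      exists k, u = 'X_[k] *: g.2) x.
Proof.
move=> [s sM].
have [gs gsG gs_span] : exists2 gs : seq ((int * int) * M),
    (forall g, g \in gs -> G g.1 g.2) &
    forall y, y \in s -> exists2 L, {subset L <= gs} & y = \sum_(g <- L) g.2.
  elim: {sM}s => [|y s [gs gsG IH]]; first by exists [::].
  have [t [f [fG yE]]] := grading_sum gG y.
  exists ([seq (a, f a) | a <- t] ++ gs) => [g|z].
    by rewrite mem_cat => /orP[/mapP[a _ ->]|/gsG //]; apply: fG.
  rewrite inE => /orP[/eqP ->|/IH[L Lgs ->]].
    exists [seq (a, f a) | a <- t]; last by rewrite big_map.
    by move=> g gt; rewrite mem_cat gt.
  by exists L => // g /Lgs ggs; rewrite mem_cat ggs orbT.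
exists gs => // x; have [c ->] := sM x.
apply: kspan_sum => i; rewrite [c i]mpolyE scaler_suml.
apply: kspan_sum => k; rewrite -mul_mpolyC -scalerA; apply: kspanZ.
have [L Lgs ->] := gs_span _ (mem_nth 0 (ltn_ord i)).
rewrite scaler_sumr big_seq; elim/big_ind: _ => [||g /Lgs ggs].
- exact: kspan0.
- exact: kspanD.
- by apply: kspan_mem; exists g => //; exists k.
Qed.

Variable gs : seq ((int * int) * M).
Hypothesis gsG : forall g, g \in gs -> G g.1 g.2.
Hypothesis gs_span : forall x, kspan (fun u => exists2 g, g \in gs &
  exists k, u = 'X_[k] *: g.2) x.

Let gdeg (j : nat) := (nth (0, 0) gs j).1.
Let gen (j : nat) := (nth (0, 0) gs j).2.

(** A pair (j, k) stands for the multiple of the [j]-th generator by the monomial of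
    exponent [k]. *)
Let T : eqType := (nat * 'X_{1..(m + mt)%N})%type.
Definition tdeg (w : T) : int * int := bideg w.2 + gdeg w.1.
Definition tvec (w : T) : M := 'X_[w.2] *: gen w.1.

(** Generator first, then the monomial order: what matters is that the order is
    total and stable under multiplication by a monomial. *)
Definition lt_t (w w' : T) : bool :=
  (w.1 < w'.1)%N || (w.1 == w'.1) && (w.2 < w'.2)%O.
Definition le_t (w w' : T) : bool :=
  (w.1 < w'.1)%N || (w.1 == w'.1) && (w.2 <= w'.2)%O.

Lemma le_t_total : total le_t.
Proof.
move=> [i k] [j l]; rewrite /le_t /=; case: (ltngtP i j) => //= _.
exact: le_total.
Qed.

Lemma le_t_trans : transitive le_t.
Proof.
move=> [j l] [i k] [h p]; rewrite /le_t /=.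
case: (ltngtP i j) => //= [ij|->].
  case: (ltngtP j h) => //= [jh|<-] _; first by rewrite (ltn_trans ij jh).
  by rewrite ij.
case: (ltngtP j h) => //= _; exact: le_trans.
Qed.

Lemma lt_t_asym u w : lt_t u w -> ~~ lt_t w u.
Proof.
case: u w => [i k] [j l]; rewrite /lt_t /=.
case: (ltngtP i j) => //= _ kl; by rewrite lt_gtF.
Qed.

Lemma lt_tE u w : lt_t u w = (u != w) && le_t u w.
Proof.
case: u w => [i k] [j l]; rewrite /lt_t /le_t xpair_eqE /=.
by case: (ltngtP i j) => //= _; rewrite lt_neqAle.
Qed.

Lemma tvec_graded w : (w.1 < size gs)%N -> G (tdeg w) (tvec w).
Proof. by move=> ws; apply/gradingX/gsG/mem_nth. Qed.

(** Write [x] as a combination of monomial multiples of the generators. Since the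
    sum of the components is direct, only the terms of bidegree [a] matter. *)
Lemma component_span a x : G a x ->
  kspan (fun u => exists w, [/\ (w.1 < size gs)%N, tdeg w = a & u = tvec w]) x.
Proof.
move=> Gx.
have [L LG xE] : exists2 L : seq ((int * int) * M),
    (forall p, p \in L -> kspan (fun u => exists w,
       [/\ (w.1 < size gs)%N, tdeg w = p.1 & u = tvec w]) p.2)
    & x = \sum_(p <- L) p.2.
  elim: (gs_span x) => [|c u y [g ggs [k ->]] _ [L LG ->]].
    by exists [::]; rewrite ?big_nil.
  have jg := nth_index (0, 0) ggs; pose w : T := (index g gs, k).
  exists ((tdeg w, c%:MP *: tvec w) :: L); last first.
    by rewrite big_cons /tvec /gen jg.
  move=> p; rewrite inE => /orP[/eqP ->|/LG //] /=.
  by apply/kspanZ/kspan_mem; exists w; rewrite index_mem.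
have LG' p : p \in L -> G p.1 p.2.
  move=> /LG; apply: kspan_graded => u [w [ws <- ->]]; exact: tvec_graded.
(* A relation between homogeneous elements, whose part of bidegree [a] expresses
   [x]. *)
have := @grading_list ((a, - x) :: L).
rewrite big_cons -xE addNr => /(_ _ erefl a) /=.
rewrite big_cons /= eqxx => /(_ _)/eqP.
rewrite addrC subr_eq0 => h.
have /h/eqP <- : forall p, p \in (a, - x) :: L -> G p.1 p.2.
  by move=> p; rewrite inE => /orP[/eqP -> /=|/LG' //]; apply: gradingN.
rewrite big_seq_cond; elim/big_ind: _ => [||p /andP[/LG + /eqP <-] //].
  exact: kspan0.
exact: kspanD.
Qed.

(** The analogue of a monomial outside the initial module in the theory of Groebner
    bases. *)
Definition standard (w : T) : bool :=
  asbool (~ kspan (fun u => exists w', [/\ (w'.1 < size gs)%N, tdeg w' = tdeg w,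
    lt_t w' w & u = tvec w']) (tvec w)).

(** If a multiple of a generator is a combination of smaller ones, multiply the
    relation by a monomial: the order and the equality of bidegrees are
    preserved, so a larger multiple is not standard either. *)
Lemma standard_downset j :
  downset (size (vars m mt)) (fun x => standard (j, mon m mt x)).
Proof.
rewrite size_vars => x y sx sy xy /asboolP sty; apply/asboolP => nx; apply: sty.
have xyM := mon_leq xy sx.
have -> : tvec (j, mon m mt y) =
    'X_[(mon m mt y - mon m mt x)%MM] *: tvec (j, mon m mt x).
  by rewrite /tvec /= scalerA -mpolyXD submK.
apply: kspan_mul nx => u [[l k] [/= ls dk lt ->]].
exists (l, (mon m mt y - mon m mt x + k)%MM); split => //.
- rewrite /tdeg /= bidegD -addrA [X in _ + X]dk /tdeg /=.
  by rewrite addrA -bidegD submK.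
- move: lt; rewrite /lt_t /=; case: (ltngtP l j) => //= _ lt.
  by rewrite -[X in (_ < X)%O](submK xyM) ltmc_add2r.
- by rewrite /tvec /= mpolyXD scalerA.
Qed.

Definition tlist (a : int * int) : seq T :=
  [seq (j, mon m mt x) | j <- iota 0 (size gs), x <- expo (vars m mt) (a - gdeg j)].

Lemma mem_tlist a w : (w \in tlist a) = (w.1 < size gs)%N && (tdeg w == a).
Proof.
apply/allpairsPdep/andP => [[j [x [+ + ->]]]|[ws /eqP wa]].
  rewrite mem_iota mem_expo size_vars => /= js /andP[/eqP sx /eqP dx].
  by rewrite /tdeg /= bideg_mon // dx subrK.
pose x : seq nat := (val w.2 : (m + mt).-tuple nat).
have sx : size x = (m + mt)%N by rewrite size_tuple.
have wE : mon m mt x = w.2 by apply: mon_val.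
exists w.1, x; rewrite mem_iota ws mem_expo size_vars sx eqxx.
rewrite wE -bideg_mon // wE -wa /tdeg addrK eqxx.
by split=> //; case: (w).
Qed.

Lemma tlist_uniq a : uniq (tlist a).
Proof.
apply: allpairs_uniq_dep; first exact: iota_uniq.
  by move=> j _; apply: uniq_expo.
move=> _ _ /allpairsPdep[j [x [_ + ->]]] /allpairsPdep[l [y [_ + ->]]] /=.
rewrite !mem_expo !size_vars => /andP[/eqP sx _] /andP[/eqP sy _] e.
by rewrite (congr1 fst e : j = l) (mon_inj sx sy (congr1 snd e)).
Qed.

(** Being standard refers to all smaller multiples of the same bidegree; in the
    sorted list of the multiples of bidegree [a] these are the earlier entries, as
    [has_dim_greedy] requires. *)
Lemma component_dim a : has_dim (G a) (count standard (tlist a)).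
Proof.
have pl : pairwise lt_t (sort le_t (tlist a)).
  have : pairwise le_t (sort le_t (tlist a)).
    rewrite -sorted_pairwise; last exact: le_t_trans.
    exact: sort_sorted le_t_total _.
  have : uniq (sort le_t (tlist a)) by rewrite sort_uniq tlist_uniq.
  rewrite uniq_pairwise => un le; have := conj un le.
  move/andP; rewrite -pairwise_relI; apply: sub_pairwise => u w /=.
  by rewrite lt_tE.
have := has_dim_greedy (v := tvec) (P := standard) lt_t_asym pl.
rewrite (permP (permEl (perm_sort _ _))) => /(_ _) h.
apply: has_dim_ext (h _) => [x|w].
  split.
    apply: kspan_graded => u [w + ->].
    by rewrite mem_sort mem_tlist => /andP[ws /eqP <-]; apply: tvec_graded.
  move/component_span; apply: kspan_sub => u [w [ws wa ->]].
  by exists w; rewrite // mem_sort mem_tlist ws wa eqxx.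
rewrite mem_sort mem_tlist => /andP[ws /eqP wa].
suff E : kspan (fun a' => exists u,
    [/\ u \in sort le_t (tlist a), lt_t u w & a' = tvec u]) (tvec w) <-> kspan (fun u => exists w', [/\ (w'.1 < size gs)%N,
    tdeg w' = tdeg w, lt_t w' w & u = tvec w']) (tvec w).
  by rewrite E; split => [/asboolP|?] //; apply/asboolP.
split; apply: kspan_sub => u [w'].
  rewrite mem_sort mem_tlist => -[/andP[w's /eqP w'a] lt ->]; exists w'.
  by rewrite wa.
move=> [w's w'a lt ->]; exists w'; split => //.
by rewrite mem_sort mem_tlist w's w'a wa eqxx.
Qed.

Lemma standard_decomposable :
  decomposable m mt (fun a => Posz (count standard (tlist a))).
Proof.
have countE a : Posz (count standard (tlist a)) = \sum_(j <- iota 0 (size gs))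
    Posz (count (fun x => standard (j, mon m mt x)) (expo (vars m mt) (a - gdeg j))).
  rewrite /tlist; elim: (iota _ _) => [|j s IH]; first by rewrite big_nil.
  by rewrite big_cons -IH /= count_cat count_map PoszD.
apply: decomposable_ext countE _; apply: decomposable_sum => j _.
have [l lb lE] := downset_cells (@standard_downset j).
exists [seq (t.1, t.2 + gdeg j) | t <- l].
  rewrite all_map; apply: sub_all lb => t /=.
  by rewrite /vars !count_cat !count_nseq /= !mul1n !mul0n addn0 add0n.
move=> a; rewrite lE big_map; apply: eq_bigr => t _.
by rewrite /cell /=; congr (geom _ _ * geom _ _); rewrite opprD addrA addrAC.
Qed.

End GradedToCells.

Theorem hilbert_series_decomposable (K : fieldType) (m mt : nat)
    (M : lmodType {mpoly K[(m + mt)%N]}) (G : int * int -> M -> Prop) H :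
  is_grading G -> finitely_generated M -> is_hilbert_series G H ->
  decomposable m mt H.
Proof.
move=> gG fgM GH; have [gs gsG gs_span] := homogeneous_generators gG fgM.
apply: decomposable_ext (standard_decomposable gs) => a.
have [d dG ->] := GH a; congr Posz.
exact: has_dim_uniq dG (component_dim gG gsG gs_span a).
Qed.

(** * Direct sums of graded modules *)

Definition realizable (K : fieldType) (m mt : nat) (H : int * int -> int) : Prop :=
  exists (M : lmodType {mpoly K[(m + mt)%N]}) (G : int * int -> M -> Prop),
    [/\ is_grading G, finitely_generated M & is_hilbert_series G H].

Lemma realizable_ext K m mt H H' : H =1 H' -> realizable K m mt H ->
  realizable K m mt H'.
Proof.
move=> E [M [G [gG fM hG]]]; exists M, G; split=> // a.
by have [d dG Ha] := hG a; exists d; rewrite // -E.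
Qed.

Lemma realizable0 K m mt : realizable K m mt (fun=> 0).
Proof.
exists 'rV[{mpoly K[(m + mt)%N]}]_0, (fun _ _ => True).
have all0 (x : 'rV[{mpoly K[(m + mt)%N]}]_0) : x = 0 by apply: thinmx0.
split=> [| |a].
- split=> // x.
  by exists [::], (fun=> 0); split=> //; rewrite big_nil; apply: all0.
- by exists [::] => x; exists (fun=> 0); rewrite big_ord0; apply: all0.
- exists 0%N => //; exists (fun=> 0); split=> // [c _ []//|x _].
  by exists (fun=> 0); rewrite big_ord0; apply: all0.
Qed.

Section DirectSum.
Variables (K : fieldType) (m mt : nat) (M M' : lmodType {mpoly K[(m + mt)%N]}).
Variables (G : int * int -> M -> Prop) (G' : int * int -> M' -> Prop).

Definition grading_pair (a : int * int) (x : M * M') : Prop :=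
  G a x.1 /\ G' a x.2.

Lemma sum_pair1 (I : Type) (s : seq I) (F : I -> M * M') :
  (\sum_(i <- s) F i).1 = \sum_(i <- s) (F i).1.
Proof. exact: (big_morph fst). Qed.

Lemma sum_pair2 (I : Type) (s : seq I) (F : I -> M * M') :
  (\sum_(i <- s) F i).2 = \sum_(i <- s) (F i).2.
Proof. exact: (big_morph snd). Qed.

Lemma is_grading_pair : is_grading G -> is_grading G' -> is_grading grading_pair.
Proof.
move=> gG gG'; split.
- by move=> a; split; [apply: grading0 gG a|apply: grading0 gG' a].
- move=> a x y [x1 x2] [y1 y2].
  by split; [apply: (gradingB gG)|apply: (gradingB gG')].
- move=> a b p x bp [x1 x2].
  by split; [apply: (gradingZ gG)|apply: (gradingZ gG')].
- move=> [x x']; have [s [f [fG ->]]] := grading_sum gG x.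
  have [s' [f' [fG' ->]]] := grading_sum gG' x'.
  pose L := [seq (a, (f a, 0)) | a <- s] ++ [seq (a, (0, f' a)) | a <- s'].
  exists (undup (map fst L)), (fun a => \sum_(p <- L | p.1 == a) p.2); split.
    move=> a; rewrite big_seq_cond; elim/big_ind: _ => [|x1 x2|p].
    + by split; [apply: grading0 gG a|apply: grading0 gG' a].
    + move=> [h1 h1'] [h2 h2'].
      by split; [apply: (gradingD gG)|apply: (gradingD gG')].
    + rewrite mem_cat => /andP[/orP[] /mapP[b _ ->] /eqP <-] /=; split => //=.
        exact: (grading0 gG').
      exact: (grading0 gG).
  rewrite -big_collect big_cat !big_map /=; apply/pair_equal_spec.
  by rewrite /= !(sum_pair1, sum_pair2) /= !big1_eq ?addr0 ?add0r.
- move=> s f us fG f0 a as_.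
  have f1 := grading_direct gG us (fun a => (fG a).1).
  have f2 := grading_direct gG' us (fun a => (fG a).2).
  rewrite [f a]surjective_pairing f1 ?f2 //.
    by rewrite -sum_pair2 f0.
  by rewrite -sum_pair1 f0.
Qed.

Lemma fg_pair : finitely_generated M -> finitely_generated M' ->
  finitely_generated (M * M')%type.
Proof.
move=> [s sM] [s' sM'].
pose S := [seq (x, 0 : M') | x <- s] ++ [seq (0 : M, x') | x' <- s'].
have szS : size S = (size s + size s')%N by rewrite size_cat !size_map.
exists S => -[x x']; have [c ->] := sM x; have [c' ->] := sM' x'.
pose d (i : nat) : {mpoly K[(m + mt)%N]} :=
  if insub i is Some j then c j
  else if insub (i - size s)%N is Some j then c' j else 0.
exists (fun i => d i).
rewrite -(big_mkord xpredT (fun i => d i *: S`_i)) szS big_mkord big_split_ord.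
rewrite /= [X in X + _](eq_bigr (fun i : 'I_(size s) => (c i *: s`_i, 0))); last first.
  move=> i _; rewrite /d /= valK nth_cat size_map ltn_ord (nth_map 0) //.
  by congr (_, _); rewrite /= scaler0.
rewrite [X in _ + X](eq_bigr (fun i : 'I_(size s') => (0, c' i *: s'`_i))); last first.
  move=> i _; rewrite /d /= insubN -?leqNgt ?leq_addr // addKn valK.
  rewrite nth_cat size_map ltnNge leq_addr /= addKn (nth_map 0) //.
  by congr (_, _); rewrite /= scaler0.
apply/pair_equal_spec.
by rewrite /= !(sum_pair1, sum_pair2) /= !big1_eq ?addr0 ?add0r.
Qed.

Lemma has_dim_pair V V' d d' : V 0 -> V' 0 -> has_dim V d -> has_dim V' d' ->
  has_dim (fun x : M * M' => V x.1 /\ V' x.2) (d + d').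
Proof.
move=> V0 V'0 [e [eV eI eS]] [e' [eV' eI' eS']].
pose E (i : 'I_(d + d')) : M * M' :=
  match split i with inl j => (e j, 0) | inr j => (0, e' j) end.
have sumE (c : 'I_(d + d') -> K) : \sum_(i < d + d') (c i)%:MP *: E i =
    (\sum_(i < d) (c (lshift d' i))%:MP *: e i,
     \sum_(i < d') (c (rshift d i))%:MP *: e' i).
  rewrite big_split_ord /=; apply/pair_equal_spec.
  rewrite /= !(sum_pair1, sum_pair2) /=; split.
    rewrite [X in _ + X]big1 ?addr0 => [|i _].
      by apply: eq_bigr => i _; rewrite /E (unsplitK (inl i)).
    by rewrite /E (unsplitK (inr i)) /= scaler0.
  rewrite [X in X + _]big1 ?add0r => [|i _].
    by apply: eq_bigr => i _; rewrite /E (unsplitK (inr i)).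
  by rewrite /E (unsplitK (inl i)) /= scaler0.
exists E; split=> [i|c|[x x'] [/= /eS[c ->] /eS'[c' ->]]].
- by rewrite /E; case: (split i) => j /=; split=> //.
- rewrite sumE => -[/eI c1 /eI' c2] i.
  by rewrite -[i]splitK; case: (split i) => j /=; [apply: c1|apply: c2].
- exists (fun i => match split i with inl j => c j | inr j => c' j end).
  rewrite sumE; congr (_, _); apply: eq_bigr => i _.
    by rewrite (unsplitK (inl i)).
  by rewrite (unsplitK (inr i)).
Qed.

End DirectSum.

Lemma realizableD K m mt H H' : realizable K m mt H -> realizable K m mt H' ->
  realizable K m mt (fun a => H a + H' a).
Proof.
move=> [M [G [gG fM hG]]] [M' [G' [gG' fM' hG']]].
exists (M * M')%type, (grading_pair G G'); split.
- exact: is_grading_pair.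
- exact: fg_pair.
- move=> a; have [d dG ->] := hG a; have [d' dG' ->] := hG' a.
  exists (d + d')%N; last by rewrite PoszD.
  apply: has_dim_pair => //; [exact: grading0 gG a|exact: grading0 gG' a].
Qed.

(** * Restriction of scalars *)

(** A copy of [S] whose scalar multiplication is through [f]. *)
Definition restr (R S : comNzRingType) (f : {rmorphism R -> S}) : Type := S.

Section Restriction.
Variables (R S : comNzRingType) (f : {rmorphism R -> S}).

HB.instance Definition _ := GRing.Zmodule.on (restr f).

Definition restr_scale (p : R) (x : restr f) : restr f := (f p * (x : S) : S).

Lemma restr_scaleA p q x :
  restr_scale p (restr_scale q x) = restr_scale (p * q) x.
Proof. by rewrite /restr_scale rmorphM mulrA. Qed.

Lemma restr_scale1 : left_id 1 restr_scale.
Proof. by move=> x; rewrite /restr_scale rmorph1 mul1r. Qed.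

Lemma restr_scaleDr : right_distributive restr_scale +%R.
Proof. by move=> p x y; rewrite /restr_scale mulrDr. Qed.

Lemma restr_scaleDl x : {morph restr_scale^~ x : p q / p + q}.
Proof. by move=> p q; rewrite /restr_scale rmorphD mulrDl. Qed.

HB.instance Definition _ := GRing.Zmodule_isLmodule.Build R (restr f)
  restr_scaleA restr_scale1 restr_scaleDr restr_scaleDl.

End Restriction.

(** * Bihomogeneous polynomials *)

(** All exponent vectors form the box with no fixed coordinate. *)
Lemma size_expo ty a : Posz (size (expo ty a)) =
  cell ((count_mem true ty, count_mem false ty), 0) a.
Proof.
pose b := nseq (size ty) (true, 0%N).
have -> : size (expo ty a) = count (inbox b) (expo ty a).
  rewrite -[LHS]count_predT; apply: eq_in_count => x.
  rewrite mem_expo => /andP[/eqP sx _]; apply/esym.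
  by rewrite /b -sx; elim: x {sx} => //= k x ->.
rewrite count_box ?size_nseq //; congr cell.
have free t : free_dirs t ty b = count_mem t ty.
  rewrite /b /free_dirs; elim: ty {b} => //= u ty ->; by rewrite andbT.
rewrite !free; congr (_, _).
by rewrite /b; elim: ty {b free} => //= t ty ->; rewrite mulr0n addr0.
Qed.

Section Bihomogeneous.
Variables (K : fieldType) (m mt : nat).
Local Notation S := {mpoly K[(m + mt)%N]}.

Lemma bihom0 a : @bihomogeneous K m mt a 0.
Proof. by move=> k; rewrite msupp0. Qed.

Lemma bihom1 : @bihomogeneous K m mt 0 1.
Proof.
move=> k; rewrite msupp1 inE => /eqP ->.
by rewrite /bideg !big1 // => i _; rewrite mnm0E.
Qed.

Lemma bihomB a (p q : S) : bihomogeneous a p -> bihomogeneous a q ->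
  bihomogeneous a (p - q).
Proof. by move=> hp hq k /msuppB_le; rewrite mem_cat => /orP[/hp|/hq]. Qed.

Lemma bihomD a (p q : S) : bihomogeneous a p -> bihomogeneous a q ->
  bihomogeneous a (p + q).
Proof. by move=> hp hq k /msuppD_le; rewrite mem_cat => /orP[/hp|/hq]. Qed.

Lemma bihomZ a c (p : S) : bihomogeneous a p -> bihomogeneous a (c *: p).
Proof. by move=> hp k /msuppZ_le /hp. Qed.

Lemma bihomM a b (p q : S) : bihomogeneous a p -> bihomogeneous b q ->
  bihomogeneous (a + b) (p * q).
Proof.
move=> hp hq k /msuppM_le /allpairsP[[k1 k2] [/= /hp <- /hq <- ->]].
exact: bidegD.
Qed.

Lemma bihomX k : @bihomogeneous K m mt (bideg k) 'X_[k].
Proof. by move=> l; rewrite msuppX inE => /eqP ->. Qed.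

Lemma bihomXn a (p : S) e : bihomogeneous a p -> bihomogeneous (a *+ e) (p ^+ e).
Proof.
move=> hp; elim: e => [|e IH]; first exact: bihom1.
by rewrite mulrS exprS; apply: bihomM.
Qed.

Lemma bihom_prod (I : Type) (s : seq I) (d : I -> int * int) (F : I -> S) :
  (forall i, bihomogeneous (d i) (F i)) ->
  bihomogeneous (\sum_(i <- s) d i) (\prod_(i <- s) F i).
Proof.
move=> hF; elim: s => [|i s IH]; first by rewrite !big_nil; apply: bihom1.
by rewrite !big_cons; apply: bihomM.
Qed.

Lemma bihom_mcoeff a (p : S) k : bihomogeneous a p -> bideg k != a -> p@_k = 0.
Proof.
move=> hp; apply: contraNeq; rewrite -mcoeff_msupp => /hp ->; exact: eqxx.
Qed.

End Bihomogeneous.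

Lemma bideg_lshift m mt (i : 'I_m) : bideg U_(lshift mt i)%MM = (1, 0).
Proof.
rewrite /bideg; congr (Posz _, Posz _).
  rewrite (bigD1 i) //= mnm1E eqxx big1 // => k ki.
  by rewrite mnm1E eq_lshift eq_sym (negbTE ki).
by rewrite big1 // => k _; rewrite mnm1E eq_lrshift.
Qed.

Lemma bideg_rshift m mt (j : 'I_mt) : bideg U_(rshift m j)%MM = (0, 1).
Proof.
rewrite /bideg; congr (Posz _, Posz _).
  by rewrite big1 // => k _; rewrite mnm1E eq_rlshift.
rewrite (bigD1 j) //= mnm1E eqxx big1 // => k kj.
by rewrite mnm1E eq_rshift eq_sym (negbTE kj).
Qed.

Lemma bideg_sum m mt (k : 'X_{1..(m + mt)%N}) :
  bideg k = \sum_i bideg U_(i)%MM *+ k i.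
Proof.
rewrite {1}[k]multinomUE_id.
have b0 : @bideg m mt 0%MM = 0.
  by rewrite /bideg !big1 // => i _; rewrite mnm0E.
rewrite (big_morph (@bideg m mt) (@bidegD m mt) b0); apply: eq_bigr => i _.
by elim: (k i) => // e IH; rewrite mulmS bidegD IH mulrS.
Qed.

(** * A module for each cell *)

Section CellModule.
Variables (K : fieldType) (m mt i j : nat).
Hypotheses (im : (i <= m)%N) (jmt : (j <= mt)%N).
Local Notation R := {mpoly K[(m + mt)%N]}.
Local Notation S := {mpoly K[(i + j)%N]}.

(** The first [i] of the X's and the first [j] of the Y's are kept, the other
    variables are sent to 0. *)
Definition kill_var (k : 'I_(m + mt)) : S :=
  match split k with
  | inl a => if insub (val a) is Some a' then 'X_(lshift j a') else 0
  | inr b => if insub (val b) is Some b' then 'X_(rshift i b') else 0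
  end.

Definition kill : R -> S := mmap (@mpolyC _ K) kill_var.
HB.instance Definition _ := GRing.RMorphism.on kill.

Lemma killC c : kill c%:MP = c%:MP.
Proof. by rewrite /kill mmapC. Qed.

Lemma kill_var_bihom k : bihomogeneous (bideg U_(k)%MM) (kill_var k).
Proof.
rewrite /kill_var -{1}[k]splitK; case: (split k) => a /=.
  case: insubP => [a' _ _|_]; last exact: bihom0.
  by rewrite bideg_lshift -(bideg_lshift j a'); apply: bihomX.
case: insubP => [a' _ _|_]; last exact: bihom0.
by rewrite bideg_rshift -(bideg_rshift i a'); apply: bihomX.
Qed.

Lemma kill_bihom b p : bihomogeneous b p -> bihomogeneous b (kill p).
Proof.
move=> hp; rewrite /kill /mmap big_seq.
elim/big_ind: _ => [||k kp]; [exact: bihom0|exact: bihomD|].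
rewrite mul_mpolyC; apply: bihomZ; rewrite -(hp k kp) bideg_sum.
by apply: bihom_prod => l; apply/bihomXn/kill_var_bihom.
Qed.

(** This makes the polynomial ring in the kept variables a cyclic module. *)
Lemma kill_surj (x : S) : exists p : R, kill p = x.
Proof.
pose g (k : 'I_(i + j)) : R :=
  match split k with
  | inl a => 'X_(lshift mt (widen_ord im a))
  | inr b => 'X_(rshift m (widen_ord jmt b))
  end.
have gE k : kill (g k) = 'X_k.
  rewrite /g -[in RHS](splitK k); case: (split k) => a /=;
    rewrite /kill mmapX mmap1U /kill_var.
    by rewrite (unsplitK (inl _)) /= valK.
  by rewrite (unsplitK (inr _)) /= valK.
exists (mmap (@mpolyC _ K) g x); rewrite [x in RHS]mpolyE /mmap rmorph_sum.
apply: eq_bigr => k _; rewrite rmorphM /= killC mul_mpolyC; congr (_ *: _).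
rewrite rmorph_prod mpolyXE_id; apply: eq_bigr => l _.
by rewrite rmorphXn /= gE.
Qed.

Variable c : int * int.

Definition cell_grading (a : int * int) (x : restr kill) : Prop :=
  bihomogeneous (a - c) (x : S).

Lemma is_grading_cell : is_grading cell_grading.
Proof.
split.
- by move=> a; apply: bihom0.
- by move=> a x y; apply: bihomB.
- move=> a b p x bp ax; rewrite /cell_grading -addrA.
  by apply: bihomM ax; apply: kill_bihom.
- move=> x; pose L := [seq (bideg k + c, (x : S)@_k *: 'X_[k] : restr kill)
    | k <- msupp (x : S)].
  exists (undup (map fst L)), (fun a => \sum_(p <- L | p.1 == a) p.2); split.
    move=> a; rewrite /cell_grading big_seq_cond.
    elim/big_ind: _ => [|p q|p]; [exact: bihom0|exact: bihomD|].
    move=> /andP[/mapP[k _ ->] /= /eqP <-]; rewrite addrK.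
    by apply/bihomZ/bihomX.
  by rewrite -big_collect big_map /= [LHS]mpolyE.
- move=> s f us fG f0 a as_; apply/mpolyP => k; rewrite mcoeff0.
  have [ka|ka] := eqVneq (bideg k) (a - c); last exact: bihom_mcoeff (fG a) ka.
  have := congr1 (mcoeff k) (f0 : \sum_(a <- s) (f a : S) = 0).
  rewrite mcoeff0 raddf_sum (bigD1_seq a) //= big1 ?addr0 // => b ba.
  apply: bihom_mcoeff (fG b) _; rewrite ka.
  by apply: contraNneq ba => /addIr ->.
Qed.

Lemma fg_cell : finitely_generated (restr kill).
Proof.
exists [:: (1 : S) : restr kill] => x.
have [p px] := kill_surj x; exists (fun=> p); rewrite big_ord1 /=.
by rewrite -[LHS]px -[LHS]mulr1.
Qed.

(** The monomials of bidegree a - c are a basis of the component of bidegree [a]. *)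
Lemma hilbert_series_cell : is_hilbert_series cell_grading (cell ((i, j), c)).
Proof.
move=> a; pose E := expo (vars i j) (a - c); exists (size E); last first.
  rewrite size_expo /vars !count_cat !count_nseq /= !mul1n !mul0n addn0 add0n.
  by rewrite /cell /= !subr0.
have szE t : t \in E -> size t = (i + j)%N.
  by rewrite mem_expo size_vars => /andP[/eqP].
pose e (t : 'I_(size E)) : 'X_{1..(i + j)%N} := mon i j (nth [::] E t).
have einj t u : (e t == e u) = (t == u).
  apply/eqP/eqP => [/mon_inj h|-> //]; apply/val_inj/eqP.
  rewrite -(nth_uniq [::] (ltn_ord t) (ltn_ord u) (uniq_expo _ _)).
  by apply/eqP/h; apply/szE/mem_nth.
have sumE (d : 'I_(size E) -> K) k :
    ((\sum_(t < size E) (d t)%:MP *: ('X_[e t] : restr kill) : restr kill)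
      : S)@_k = \sum_(t < size E) d t * (e t == k)%:R.
  rewrite raddf_sum; apply: eq_bigr => t _ /=.
  by rewrite [_ *: _]/(kill _ * _) killC mcoeffCM mcoeffX.
have eE k : bideg k = a - c -> exists t, e t = k.
  move=> ka; pose x : seq nat := (val k : (i + j).-tuple nat).
  have sx : size x = (i + j)%N by rewrite size_tuple.
  have xk : mon i j x = k by apply: mon_val.
  have xE : x \in E by rewrite mem_expo size_vars sx -bideg_mon // xk ka !eqxx.
  have xlt : (index x E < size E)%N by rewrite index_mem.
  by exists (Ordinal xlt); rewrite /e /= nth_index.
have eb t : bideg (e t) = a - c.
  have : nth [::] E t \in E by apply: mem_nth.
  rewrite /e; move: (nth _ _ _) => x xE; rewrite bideg_mon ?szE //.
  by move: xE; rewrite mem_expo => /andP[_ /eqP].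
have sumEe (d : 'I_(size E) -> K) t :
    \sum_(u < size E) d u * (e u == e t)%:R = d t.
  rewrite (bigD1 t) //= eqxx mulr1 big1 ?addr0 // => u ut.
  by rewrite einj (negbTE ut) mulr0.
exists (fun t => 'X_[e t] : restr kill); split=> [t|d d0 t|x xG].
- by rewrite /cell_grading -(eb t); apply: bihomX.
- have := congr1 (mcoeff (e t)) (d0 : _ = 0 :> S).
  by rewrite sumE sumEe mcoeff0.
- exists (fun t => (x : S)@_(e t)); apply/mpolyP => k; rewrite sumE.
  have [/eE[t <-]|nk] := eqVneq (bideg k) (a - c); first by rewrite sumEe.
  rewrite (bihom_mcoeff xG nk) big1 // => t _; case: eqP => [tk|_].
    by case/eqP: nk; rewrite -tk eb.
  by rewrite mulr0.
Qed.

Lemma realizable_cell : realizable K m mt (cell ((i, j), c)).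
Proof.
exists (restr kill), cell_grading; split.
- exact: is_grading_cell.
- exact: fg_cell.
- exact: hilbert_series_cell.
Qed.

End CellModule.

Theorem decomposable_realizable K m mt H : decomposable m mt H ->
  realizable K m mt H.
Proof.
move=> [l lmn HE].
apply: realizable_ext (fun a => esym (HE a)) _.
elim: l lmn {HE} => [_|[[i j] c] l IH /= /andP[/andP[im jmt] /IH lr]].
  by apply: realizable_ext (realizable0 K m mt) => a; rewrite big_nil.
apply: realizable_ext (realizableD (realizable_cell K im jmt c) lr) => a.
by rewrite big_cons.
Qed.

Theorem proposition5p1 (K : fieldType) (m mt : nat) (H : int * int -> int)
    (HL : laurent_series H) :
  (exists (M : lmodType {mpoly K[(m + mt)%N]}) (G : int * int -> M -> Prop),
     [/\ is_grading G, finitely_generated M & is_hilbert_series G H])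
  <->
  [/\ nonneg_series H,
      laurent_polynomial (mul_series H (denom m mt))
    & positive_extremal_coefs (hilbert_poly H)].
Proof.
split=> [[M [G [gG fgM GH]]]|[H_ge0 HQ Hext]].
  have dH := hilbert_series_decomposable gG fgM GH; split.
  - exact: decomposable_ge0 dH.
  - exact: decomposable_laurent dH.
  - exact: decomposable_extremal dH.
exact/(decomposable_realizable K)/conditions_decomposable.
Qed.
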